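(* Let $A$ be a unitarizable Hopf $*$-algebra and $Z$ an $A$-$*$-Galois extension with a positive Haar measure. Let $\widehat A$ be the set of isomorphism classes of irreducible finite-dimensional $A$-comodules and $n_\lambda$ the dimension of a representative of $\lambda\in\widehat A$. Then $Z=\bigoplus_{\lambda\in\widehat A}Z(\lambda)$ where each $Z(\lambda)$ is a sub-$A$-comodule of dimension $n_\lambda p_\lambda$ for some positive integer $p_\lambda$; for each $\lambda$ there is a basis $(z^\lambda_{ij})_{1\le i\le n_\lambda,1\le j\le p_\lambda}$ of $Z(\lambda)$ with $\sum_{i=1}^{n_\lambda}(z^\lambda_{ij})^*z^\lambda_{ik}=\delta_{jk}$ and $\sum_{j=1}^{p_\lambda}z^\lambda_{ij}(z^\lambda_{kj})^*=\delta_{ik}$; and there is a basis $(a^\lambda_{ij})_{\lambda\in\widehat A,1\le i,j\le n_\lambda}$ of $A$ such that each matrix $(a^\lambda_{ij})_{i,j}$ is unitary and $\alpha_Z(z^\lambda_{ij})=\sum_{k=1}^{n_\lambda}a^\lambda_{ik}\otimes z^\lambda_{kj}$.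
   Context: Base field $\mathbb C$. A Hopf $*$-algebra is a Hopf algebra that is a $*$-algebra with $\Delta$ a $*$-homomorphism; unitarizable means every finite-dimensional right comodule $V$ admits a scalar product $\phi_V:\overline V\otimes V\to\mathbb C$ that is a comodule map ($\overline V$ the conjugate comodule, $\overline v\mapsto\sum\overline{v_i}\otimes a_i^*$ if $\alpha_V(v)=\sum v_i\otimes a_i$). An $A$-$*$-Galois extension is a nonzero $*$-algebra $Z$ with a left coaction $\alpha_Z:Z\to A\otimes Z$ that is a $*$-homomorphism and with $(1_A\otimes m_Z)(\alpha_Z\otimes 1_Z):Z\otimes Z\to A\otimes Z$ bijective. A Haar measure on $Z$: linear $\mu$ with $(1_A\otimes\mu)\alpha_Z=\mu(\cdot)1_A$, $\mu(1)=1$; positive if $\mu(z^*z)\ge0$. A matrix $(a_{ij})$ over a $*$-algebra is unitary if $a^*a=aa^*=1$ with $(a^* )_{ij}=a_{ji}^*$. *)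

(* Defs.v *)
From HB Require Import structures.
From mathcomp Require Import all_boot all_order all_algebra.
From mathcomp Require Import complex Rstruct.
Set Implicit Arguments. Unset Strict Implicit. Unset Printing Implicit Defensive.
Import Order.TTheory GRing.Theory Num.Theory.
Local Open Scope ring_scope.

Notation C := (Rdefinitions.R[i]).

(** Algebraic tensors U ⊗ V are represented by finite sums of elementary
    tensors, i.e. by lists of pairs; two representatives denote the same
    tensor iff they agree on all products of linear functionals
    (V ⊗ W embeds into bilinear forms on V^* × W^*, over a field). *)
Definition teq (U V : lmodType C) (s t : seq (U * V)) : Prop :=
  forall (f : {scalar U}) (g : {scalar V}),
    \sum_(p <- s) f p.1 * g p.2 = \sum_(p <- t) f p.1 * g p.2.

Definition teq3 (U V W : lmodType C) (s t : seq ((U * V) * W)) : Prop :=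
  forall (f : {scalar U}) (g : {scalar V}) (h : {scalar W}),
    \sum_(p <- s) f p.1.1 * g p.1.2 * h p.2
    = \sum_(p <- t) f p.1.1 * g p.1.2 * h p.2.

Definition tmul (A B : algType C) (s t : seq (A * B)) : seq (A * B) :=
  [seq (p.1 * q.1, p.2 * q.2) | p <- s, q <- t].

Definition tlinear (U V W : lmodType C) (d : U -> seq (V * W)) : Prop :=
  forall (c : C) (x y : U),
    teq (d (c *: x + y)) ([seq (c *: p.1, p.2) | p <- d x] ++ d y).

Definition star_structure (A : algType C) (st : A -> A) : Prop :=
  [/\ involutive st,
      forall x y : A, st (x + y) = st x + st y,
      forall (c : C) (x : A), st (c *: x) = c^* *: st x
    & forall x y : A, st (x * y) = st y * st x].

Definition is_hopf_star_algebra (A : algType C) (Delta : A -> seq (A * A))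
    (eps : A -> C) (S : A -> A) (st : A -> A) : Prop :=
  [/\
      [/\ tlinear Delta,
          (forall x y, teq (Delta (x * y)) (tmul (Delta x) (Delta y))),
          teq (Delta 1) [:: (1, 1)]
        & forall x,
            teq3 [seq ((q.1, q.2), p.2) | p <- Delta x, q <- Delta p.1]
                 [seq ((p.1, q.1), q.2) | p <- Delta x, q <- Delta p.2]],
      [/\ forall (c : C) x y, eps (c *: x + y) = c * eps x + eps y,
          forall x y, eps (x * y) = eps x * eps y,
          eps 1 = 1,
          forall x, \sum_(p <- Delta x) eps p.1 *: p.2 = x
        & forall x, \sum_(p <- Delta x) eps p.2 *: p.1 = x],
      [/\ forall (c : C) x y, S (c *: x + y) = c *: S x + S y,
          forall x, \sum_(p <- Delta x) S p.1 * p.2 = (eps x)%:A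
        & forall x, \sum_(p <- Delta x) p.1 * S p.2 = (eps x)%:A],
      star_structure st
    & forall x, teq (Delta (st x)) [seq (st p.1, st p.2) | p <- Delta x]].

(** Matrix corepresentations: u ∈ M_n(A) with Δ(u_ij) = Σ_k u_ik ⊗ u_kj and
    ε(u_ij) = δ_ij.  These are exactly the coefficient matrices of the
    n-dimensional right comodules C^n with α(e_j) = Σ_i e_i ⊗ u_ij. *)
Definition is_corep (A : algType C) (Delta : A -> seq (A * A)) (eps : A -> C)
    (n : nat) (u : 'M[A]_n) : Prop :=
  (forall i j, teq (Delta (u i j)) [seq (u i k, u k j) | k <- enum 'I_n]) /\
  (forall i j, eps (u i j) = (i == j)%:R).

(** Unitarizability: every finite-dimensional comodule C^n (with coaction
    given by a corepresentation u) carries a scalar product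
    φ(ē_i ⊗ e_k) = H_ik (H positive definite Hermitian) that is a comodule
    map V̄ ⊗ V -> C, i.e. Σ_{i,k} H_ik u_ij^* u_km = H_jm 1. *)
Definition unitarizable (A : algType C) (Delta : A -> seq (A * A))
    (eps : A -> C) (st : A -> A) : Prop :=
  forall (n : nat) (u : 'M[A]_n), is_corep Delta eps u ->
  exists H : 'M[C]_n,
    [/\ forall i j, H j i = (H i j)^*,
        forall v : 'cV[C]_n, v != 0 -> 0 < ((map_mx Num.conj v)^T *m H *m v) 0 0
      & forall j m, \sum_i \sum_k H i k *: (st (u i j) * u k m) = H j m *: 1].

Definition is_star_galois (A Z : algType C) (Delta : A -> seq (A * A))
    (eps : A -> C) (stA : A -> A) (stZ : Z -> Z) (alpha : Z -> seq (A * Z))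
    : Prop :=
  [/\ (1 : Z) != 0,
      star_structure stZ,
      [/\ tlinear alpha,
          (forall z, teq3 [seq ((p.1, q.1), q.2) | p <- alpha z, q <- alpha p.2]
                          [seq ((q.1, q.2), p.2) | p <- alpha z, q <- Delta p.1])
        & forall z, \sum_(p <- alpha z) eps p.1 *: p.2 = z],
      [/\ forall z w, teq (alpha (z * w)) (tmul (alpha z) (alpha w)),
          teq (alpha 1) [:: (1, 1)]
        & forall z, teq (alpha (stZ z)) [seq (stA p.1, stZ p.2) | p <- alpha z]]
    &
      let beta (t : seq (Z * Z)) : seq (A * Z) :=
        [seq (q.1, q.2 * p.2) | p <- t, q <- alpha p.1] in
      (forall t, teq (beta t) [::] -> teq t [::]) /\
      (forall s : seq (A * Z), exists t, teq (beta t) s)].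

Definition positive_haar_measure (A Z : algType C) (alpha : Z -> seq (A * Z))
    (stZ : Z -> Z) (mu : Z -> C) : Prop :=
  [/\ forall (c : C) x y, mu (c *: x + y) = c * mu x + mu y,
      forall z, \sum_(p <- alpha z) mu p.2 *: p.1 = mu z *: (1 : A),
      mu 1 = 1
    & forall z, 0 <= mu (stZ z * z)].

(** Irreducible corepresentation: n > 0 and C^n has no comodule subspaces
    besides 0 and C^n.  A subspace (row space of W, in coordinates) is a
    subcomodule iff it is stable under all (id ⊗ f)∘α, f ∈ A^*. *)
Definition irr_corep (A : algType C) (Delta : A -> seq (A * A)) (eps : A -> C)
    (n : nat) (u : 'M[A]_n) : Prop :=
  [/\ is_corep Delta eps u, (0 < n)%N
    & forall W : 'M[C]_n,
        (forall f : {scalar A}, (W *m (map_mx f u)^T <= W)%MS) ->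
        \rank W = 0%N \/ \rank W = n].

Definition corep_equiv (A : algType C) (n m : nat) (u : 'M[A]_n)
    (v : 'M[A]_m) : Prop :=
  exists T : 'M[C]_(m, n),
    [/\ m = n, \rank T = n
      & map_mx (in_alg A) T *m u = v *m map_mx (in_alg A) T].

Definition mx_star (A : algType C) (st : A -> A) (n : nat) (u : 'M[A]_n)
  : 'M[A]_n := \matrix_(i, j) st (u j i).

Definition free_family (V : lmodType C) (J : Type) (x : J -> V) : Prop :=
  forall (m : nat) (f : 'I_m -> J) (c : 'I_m -> C),
    injective f -> \sum_(k < m) c k *: x (f k) = 0 -> forall k, c k = 0.

Definition spanning_family (V : lmodType C) (J : Type) (x : J -> V) : Prop :=
  forall v : V, exists (m : nat) (f : 'I_m -> J) (c : 'I_m -> C),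
    v = \sum_(k < m) c k *: x (f k).

Definition basis_family (V : lmodType C) (J : Type) (x : J -> V) : Prop :=
  free_family x /\ spanning_family x.

(* Main.v *)
Require Import Defs.
From HB Require Import structures.
From mathcomp Require Import all_boot all_order all_algebra.
From mathcomp Require Import complex Rstruct.
From mathcomp Require Import boolp classical_sets.
Import Order.TTheory GRing.Theory Num.Theory.
Local Open Scope ring_scope.
Local Open Scope classical_set_scope.

Set Implicit Arguments. Unset Strict Implicit. Unset Printing Implicit Defensive.

(* Functionals separate points (Zorn), so a tensor, given as a list of pairs, is
   known from its slices by functionals, and an identity between coactions becomes
   an identity between the complex matrices f(u), f in the dual of A.

   For A: each x lies in the finite-dimensional subcomodule of its translates,
   invariant scalar products split corepresentations, and Jacobson density for
   the irreducible ones gives functionals dual to the coefficients a^l_ij.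

   For Z: call z equivariant for u when alpha(z_ij) = sum_k u_ik (x) z_kj. Slicing
   alpha by the dual functionals shows that Z is spanned by the entries of columns
   equivariant for some a^l. Surjectivity of the Galois map gives an equivariant
   matrix w with a right inverse y; injectivity gives v (x) 1 = sum_k w_k (x) (y v)_k,
   hence v = w mu(y v), for each equivariant column v. When u = w = y = 1 this says
   that coinvariants are scalars. So, a^l being unitary, w^* w is a complex matrix,
   which positivity of mu makes positive semidefinite: it is R^* R with R Q = 1 for
   some Q. Then z = w Q satisfies z^* z = 1 and w = z R, and z (R y) = 1 forces
   z^* = R y. *)

(** * Subspaces and functionals *)

Lemma choice_dep (X : Type) (Y : X -> Type) (P : forall x, Y x -> Prop) :
  (forall x, exists y, P x y) -> exists f : forall x, Y x, forall x, P x (f x).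
Proof. by move=> exP; exists (fun x => sval (cid (exP x))) => x; case: cid. Qed.

Section LinearOf.
Variables (R : pzRingType) (U : lmodType R) (V : zmodType) (s : GRing.Scale.law R V).
Variables (f : U -> V) (f_linear : linear_for s f).

Lemma linear_exists : {F : {linear U -> V | s} | F =1 f}.
Proof.
pose F : {linear U -> V | s} := HB.pack f (GRing.isLinear.Build R U V s f f_linear).
by exists F.
Qed.

Definition linear_of : {linear U -> V | s} := sval linear_exists.

Lemma linear_ofE : linear_of =1 f.
Proof. exact: svalP linear_exists. Qed.

End LinearOf.

Lemma scalar_combination (R : comPzRingType) (V : lmodType R) (c : R) (f g : {scalar V}) :
  scalar (fun x => c * f x + g x).
Proof. by move=> d x y; rewrite !linearP /= !mulrDr addrACA mulrCA. Qed.

Section Subspace.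
Variables (R : pzRingType) (V : lmodType R).
Implicit Types (P M : set V) (v : V).

Definition subspace P : Prop :=
  P 0 /\ forall c x y, P x -> P y -> P (c *: x + y).

Section Closure.
Variables (P : set V) (subP : subspace P).

Lemma subspace0 : P 0.
Proof. exact: subP.1. Qed.

Lemma subspaceZ c x : P x -> P (c *: x).
Proof. by move=> Px; rewrite -[_ *: _]addr0; apply: subP.2 subspace0. Qed.

Lemma subspaceD x y : P x -> P y -> P (x + y).
Proof. by move=> Px Py; rewrite -[x]scale1r; apply: subP.2. Qed.

Lemma subspaceB x y : P x -> P y -> P (x - y).
Proof. by move=> Px Py; rewrite addrC -scaleN1r; apply: subP.2. Qed.

Lemma subspace_sum (J : Type) (s : seq J) (Q : pred J) (E : J -> V) :
  (forall j, Q j -> P (E j)) -> P (\sum_(j <- s | Q j) E j).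
Proof. by move=> PE; apply: big_ind PE; [apply: subspace0 | apply: subspaceD]. Qed.

End Closure.

Lemma subspace_bigcup_chain (chain : set (set V)) :
  chain !=set0 -> chain `<=` subspace -> total_on chain subset ->
  subspace (\bigcup_(P in chain) P).
Proof.
move=> [P0 chainP0] chain_sub chain_tot; split.
  by exists P0 => //; apply: subspace0 (chain_sub _ chainP0).
move=> c x y [P chainP Px] [Q chainQ Qy].
have [PQ|QP] := chain_tot _ _ chainP chainQ.
  by exists Q => //; apply: (chain_sub _ chainQ).2 (PQ _ Px) Qy.
by exists P => //; apply: (chain_sub _ chainP).2 Px (QP _ Qy).
Qed.

Definition span M : set V := smallest subspace M.

Lemma mem_span M v : M v -> span M v.
Proof. exact: sub_gen_smallest. Qed.

Lemma subspace_span M : subspace (span M).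
Proof.
split=> [P [subP _]|c x y Mx My P [subP MP]]; first exact: subspace0.
by apply: subP.2; [apply: Mx | apply: My].
Qed.

Lemma span_imageP (J : Type) (x : J -> V) (D : set J) v :
  span (x @` D) v ->
  exists (m : nat) (f : 'I_m -> J) (c : 'I_m -> R),
    (forall k, D (f k)) /\ v = \sum_(k < m) c k *: x (f k).
Proof.
move: v; apply: smallest_sub; last first.
  move=> _ [j Dj <-]; exists 1, (fun=> j), (fun=> 1).
  by rewrite big_ord1 scale1r.
split=> [|b _ _ [m [f [c [Df ->]]]] [n [g [d [Dg ->]]]]].
  exists 0, (fun k : 'I_0 => False_rect J (notF (ltn_ord k))), (fun=> 0).
  by split=> [[]//|]; rewrite big_ord0.
exists (m + n), (fun k => match split k with inl i => f i | inr i => g i end).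
exists (fun k => match split k with inl i => b * c i | inr i => d i end); split.
  by move=> k; case: split.
rewrite big_split_ord scaler_sumr; congr (_ + _); apply: eq_bigr => k _.
  by rewrite -[lshift _ _]/(unsplit (inl k)) unsplitK scalerA.
by rewrite -[rshift _ _]/(unsplit (inr k)) unsplitK.
Qed.

End Subspace.

Lemma Zorn_bigcup_nonempty (T : Type) (good : set (set T)) :
  good !=set0 ->
  (forall chain, chain !=set0 -> chain `<=` good -> total_on chain subset ->
     good (\bigcup_(X in chain) X)) ->
  exists2 X, good X & forall Y, good Y -> X `<=` Y -> Y `<=` X.
Proof.
move=> [X0 goodX0] good_chain.
have [chain chainP chain_tot|X [goodX Xmax]] := @Zorn_bigcup T (good `|` [set set0]).
  have -> : \bigcup_(X in chain) X = \bigcup_(X in chain `&` good) X.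
    apply/seteqP; split=> x [X cX Xx]; last by exists X; first exact: cX.1.
    by exists X => //; split=> //; have [//|X_0] := chainP _ cX; rewrite X_0 in Xx.
  have [->|/set0P cgood] := eqVneq (chain `&` good) set0.
    by right; rewrite bigcup_set0.
  by left; apply: good_chain => // X Y [cX _] [cY _]; apply: chain_tot.
have maxX Y : good Y -> X `<=` Y -> Y `<=` X.
  by move=> gY XY; apply: contrapT => nYX; apply: (Xmax Y) => //; left.
have [gX|X_0] := goodX; first by exists X.
suff gX : good X by exists X.
have X_sub : X `<=` X0 by rewrite X_0; apply: sub0set.
by rewrite (_ : X = X0) //; apply/seteqP; split; last exact: maxX.
Qed.

Section Separation.
Variables (F : fieldType) (V : lmodType F).

Lemma maximal_subspace_avoiding (M : set V) v :
  subspace M -> ~ M v ->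
  exists X, [/\ subspace X, M `<=` X, ~ X v
    & forall Y, subspace Y -> X `<=` Y -> ~ Y v -> Y `<=` X].
Proof.
move=> subM Mv; pose good X := [/\ subspace X, M `<=` X & ~ X v].
have [|chain [X0 cX0] cgood ctot|X [subX MX Xv] Xmax] := @Zorn_bigcup_nonempty V good.
- by exists M; split.
- split=> [|x Mx|[X cX Xv]].
  + by apply: subspace_bigcup_chain => // [|X /cgood[]//]; exists X0.
  + by exists X0 => //; have [_ MX0 _] := cgood _ cX0; apply: MX0.
  + by have [] := cgood _ cX.
- exists X; split=> // Y subY XY Yv; apply: Xmax => //.
  by split=> //; apply: subset_trans XY.
Qed.

Lemma maximal_avoiding_decomposition (X : set V) v :
  subspace X -> ~ X v ->
  (forall Y, subspace Y -> X `<=` Y -> ~ Y v -> Y `<=` X) ->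
  forall x, exists c, X (x - c *: v).
Proof.
move=> subX Xv Xmax x; have [Xx|Xx] := pselect (X x).
  by exists 0; rewrite scale0r subr0.
pose Y := [set y | exists c, X (y - c *: x)].
have subY : subspace Y.
  split=> [|c y z [d Xd] [e Xe]].
    by exists 0; rewrite scale0r subr0; apply: subspace0.
  exists (c * d + e); have := subX.2 c _ _ Xd Xe.
  by rewrite scalerBr scalerDl opprD scalerA addrACA.
have XY : X `<=` Y by move=> y Xy; exists 0; rewrite scale0r subr0.
have Yx : Y x by exists 1; rewrite scale1r subrr; apply: subspace0.
have [[c Xc]|Yv] := pselect (Y v); last by case: Xx; apply: Xmax Yx.
exists c^-1; have c_neq0 : c != 0.
  by apply: contra_not_neq Xv => c0; rewrite c0 scale0r subr0 in Xc.
have := subspaceZ subX (- c^-1) Xc.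
by rewrite scalerBr !scaleNr opprK scalerA mulVf // scale1r addrC.
Qed.

Lemma separating_functional (M : set V) v :
  subspace M -> ~ M v ->
  exists2 f : {scalar V}, f v = 1 & forall x, M x -> f x = 0.
Proof.
move=> subM /(maximal_subspace_avoiding subM)[X [subX MX Xv Xmax]].
have /choice[f fX] := maximal_avoiding_decomposition subX Xv Xmax.
have f_unique x c : X (x - c *: v) -> f x = c.
  move=> Xc; apply: contra_not_eq Xv => fc.
  have := subspaceB subX Xc (fX x).
  rewrite opprB addrC addrA subrK -scalerBl => /(subspaceZ subX (f x - c)^-1).
  by rewrite scalerA mulVf ?subr_eq0 // scale1r.
have f_scalar : scalar f.
  move=> c x y; apply: f_unique; have := subX.2 c _ _ (fX x) (fX y).
  by rewrite scalerBr scalerDl opprD scalerA addrACA.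
exists (linear_of f_scalar) => [|x Mx]; rewrite linear_ofE; apply: f_unique.
  by rewrite scale1r subrr; apply: subspace0.
by rewrite scale0r subr0; apply: MX.
Qed.

Lemma span_functional (M : set V) v :
  (forall f : {scalar V}, (forall x, M x -> f x = 0) -> f v = 0) -> span M v.
Proof.
move=> fMv; apply: contrapT => /(separating_functional (subspace_span M))[f fv1 fM].
suff /eqP : f v = 0 by rewrite fv1 oner_eq0.
by apply: fMv => x Mx; apply: fM; apply: mem_span.
Qed.

Lemma functional_ext (x y : V) : (forall f : {scalar V}, f x = f y) -> x = y.
Proof.
move=> fxy; apply/eqP; rewrite -subr_eq0; apply/eqP.
have /(_ [set 0]) : span set0 (x - y).
  by apply: span_functional => f _; rewrite raddfB /= fxy subrr.
by apply; split=> //; split=> // c _ _ -> ->; rewrite scaler0 addr0.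
Qed.

End Separation.

Section Biorthogonal.
Variables (F : fieldType) (V : lmodType F).

Definition biorthogonal (J : eqType) (g : J -> {scalar V}) (e : J -> V) : Prop :=
  forall i j, g i (e j) = (i == j)%:R.

Lemma biorthogonal_sum (J : finType) (g : J -> {scalar V}) (e : J -> V) c :
  biorthogonal g e -> forall i, g i (\sum_j c j *: e j) = c i.
Proof.
move=> ge i; rewrite raddf_sum (bigD1 i) //= big1 => [|j ji].
  by rewrite linearZ /= ge eqxx mulr1 addr0.
by rewrite linearZ /= ge eq_sym (negPf ji) mulr0.
Qed.

Lemma subspace_expansion (J : finType) (g : J -> {scalar V}) (e : J -> V) :
  subspace [set x | x = \sum_j g j x *: e j].
Proof.
split=> [|c x y /= xE yE]; first by rewrite /= big1 // => j _; rewrite raddf0 scale0r.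
rewrite {1}xE {1}yE scaler_sumr -big_split; apply: eq_bigr => j _ /=.
by rewrite linearP scalerDl scalerA.
Qed.

Lemma separating_residual (J : finType) (g : J -> {scalar V}) (e : J -> V) x :
  biorthogonal g e -> x != \sum_j g j x *: e j ->
  exists2 h : {scalar V}, h x = 1 & forall j, h (e j) = 0.
Proof.
move=> ge /eqP xN.
have [h hx h0] := separating_functional (subspace_expansion g e) xN.
exists h => // j; apply: h0; rewrite /= (bigD1 j) //= ge eqxx scale1r.
by rewrite big1 ?addr0 // => i /negPf ij; rewrite ge ij scale0r.
Qed.

Lemma seq_biorthogonal_basis (s : seq V) :
  exists (m : nat) (e : 'I_m -> V) (g : 'I_m -> {scalar V}),
    [/\ biorthogonal g e,
        {in s, forall x, x = \sum_i g i x *: e i}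
      & forall i, span [set` s] (e i)].
Proof.
elim: s => [|x s [m [e [g [ge gs e_s]]]]].
  exists 0, (fun=> 0), (fun=> \0 : {scalar V}).
  by split=> [[]|x|[]].
have e_xs i : span [set` x :: s] (e i).
  apply: sub_smallest2r (e_s i); first exact: subspace_span.
  by move=> y /= ys; rewrite inE ys orbT.
have [xE|] := eqVneq x (\sum_i g i x *: e i).
  by exists m, e, g; split=> // y; rewrite inE => /predU1P[->|/gs].
move=> /(separating_residual ge)[h hx he].
pose r := x - \sum_i g i x *: e i.
have gr i : g i r = 0 by rewrite raddfB /= biorthogonal_sum // subrr.
have hr : h r = 1.
  by rewrite raddfB /= hx raddf_sum big1 ?subr0 // => i _; rewrite /= linearZ /= he mulr0.
exists m.+1, (fun i => oapp e r (unlift ord0 i)), (fun i => oapp g h (unlift ord0 i)).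
have expand y : \sum_i oapp g h (unlift ord0 i) y *: oapp e r (unlift ord0 i)
    = h y *: r + \sum_i g i y *: e i.
  rewrite big_ord_recl unlift_none; congr (_ + _).
  by apply: eq_bigr => i _; rewrite liftK.
split.
- by move=> i j; case: unliftP => [i' ->|->]; case: unliftP => [j' ->|->] //=.
- move=> y; rewrite expand inE => /predU1P[->|/gs ys].
    by rewrite hx scale1r subrK.
  suff -> : h y = 0 by rewrite scale0r add0r.
  by rewrite ys raddf_sum big1 // => i _; rewrite /= linearZ /= he mulr0.
- move=> i; case: unliftP => [i' _|_] /=; first exact: e_xs.
  have subs := subspace_span [set` x :: s].
  apply: (subspaceB subs); first by apply: mem_span; rewrite /= mem_head.
  by apply: (subspace_sum subs) => j _; apply: (subspaceZ subs).
Qed.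

Lemma subspace_biorthogonal_basis (P : set V) (s : seq V) :
  subspace P -> [set` s] `<=` P -> P `<=` span [set` s] ->
  exists (m : nat) (e : 'I_m -> V) (g : 'I_m -> {scalar V}),
    [/\ biorthogonal g e, forall i, P (e i)
      & forall x, P x -> x = \sum_i g i x *: e i].
Proof.
move=> subP sP Ps; have [m [e [g [ge gs e_s]]]] := seq_biorthogonal_basis s.
have s_expand := smallest_sub (subspace_expansion g e) gs.
by exists m, e, g; split=> // [i|x /Ps/s_expand //]; apply: smallest_sub sP _ (e_s i).
Qed.

Section InfiniteFamily.
Variables (J : eqType) (x : J -> V).

Lemma finitely_separated_biorthogonal :
  (forall j (s : seq J), j \notin s ->
     exists2 g : {scalar V}, g (x j) = 1 & {in s, forall i, g (x i) = 0}) ->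
  exists g : J -> {scalar V}, biorthogonal g x.
Proof.
move=> sepx.
suff /choice[g gx] j : exists g : {scalar V}, forall i, g (x i) = (j == i)%:R by exists g.
have sub_others := subspace_span (x @` [set i | i != j]).
have [|g gj g0] := separating_functional sub_others (v := x j).
  move=> /span_imageP[m [f [c [fj xjE]]]].
  have [|g gj gf] := sepx j (codom f).
    by apply/negP => /codomP[k jk]; have /eqP := fj k; rewrite -jk.
  move/eqP: gj; rewrite xjE raddf_sum big1 ?(eq_sym 0) ?oner_eq0 // => k _ /=.
  by rewrite linearZ /= gf ?codom_f // mulr0.
exists g => i; have [<-//|ji] := eqVneq j i.
by apply: g0; apply: mem_span; exists i; rewrite //= eq_sym.
Qed.

Variable g : J -> {scalar V}.
Hypothesis gx : biorthogonal g x.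

Lemma biorthogonal_span_eq0 v : span (range x) v -> (forall j, g j v = 0) -> v = 0.
Proof.
move=> /span_imageP[m [f [c [_ vE]]]] gv0.
suff -> : v = \sum_(j <- undup (codom f)) g j v *: x j.
  by rewrite big1 // => j _; rewrite gv0 scale0r.
rewrite [in RHS]vE; under eq_bigr do rewrite raddf_sum scaler_suml.
rewrite exchange_big vE; apply: eq_bigr => k _ /=.
rewrite (bigD1_seq (f k)) ?undup_uniq ?mem_undup ?codom_f //= linearZ /= gx eqxx mulr1.
rewrite big1 ?addr0 // => j /negPf jk; rewrite linearZ /= gx jk mulr0.
by rewrite scale0r.
Qed.

End InfiniteFamily.

End Biorthogonal.

(** * Positive semidefinite matrices *)

Section PositiveMatrices.
Local Open Scope sesquilinear_scope.
Variable F : numClosedFieldType.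

Lemma trmxC_mul m n p (P : 'M[F]_(m, n)) (Q : 'M[F]_(n, p)) :
  (P *m Q)^t* = Q^t* *m P^t*.
Proof. by rewrite trmx_mul map_mxM. Qed.

Definition psdmx n (H : 'M[F]_n) : Prop :=
  H^t* = H /\ forall v : 'cV_n, 0 <= (v^t* *m H *m v) 0 0.

Definition posdefmx n (H : 'M[F]_n) : Prop :=
  H^t* = H /\ forall v : 'cV_n, v != 0 -> 0 < (v^t* *m H *m v) 0 0.

Lemma posdef_psdmx n (H : 'M[F]_n) : posdefmx H -> psdmx H.
Proof.
move=> [Hherm Hpos]; split=> // v; have [->|/Hpos/ltW //] := eqVneq v 0.
by rewrite mulmx0 mxE.
Qed.

Lemma posdef_unitmx n (H : 'M[F]_n) : posdefmx H -> H \in unitmx.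
Proof.
move=> [_ Hpos]; rewrite -unitmx_tr -row_free_unit -kermx_eq0; apply: contraT.
rewrite -nz_row_eq0 -trmx_eq0 => /Hpos; rewrite -mulmxA.
suff -> : H *m (nz_row (kermx H^T))^T = 0 by rewrite mulmx0 mxE ltxx.
apply: trmx_inj; rewrite trmx_mul trmxK trmx0.
by apply/sub_kermxP/nz_row_sub.
Qed.

Lemma psdmx_congr m n (H : 'M[F]_m) (Q : 'M[F]_(m, n)) :
  psdmx H -> psdmx (Q^t* *m H *m Q).
Proof.
move=> [Hherm Hpos]; split; first by rewrite !trmxC_mul trmxCK Hherm mulmxA.
by move=> v; have := Hpos (Q *m v); rewrite trmxC_mul !mulmxA.
Qed.

Lemma posdef_ulsubmx r s (H : 'M[F]_(r + s)) : posdefmx H -> posdefmx (ulsubmx H).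
Proof.
move=> [Hherm Hpos]; split.
  by rewrite -[in RHS]Hherm -map_ulsubmx -trmx_ulsub.
move=> v v_neq0; have := Hpos (col_mx v 0).
rewrite -{1}(submxK H) tr_col_mx map_row_mx trmx0 map_mx0 mul_row_block mul_row_col.
rewrite !mul0mx !mulmx0 !addr0; apply.
by rewrite col_mx_eq0 negb_and v_neq0.
Qed.

Lemma psdmx_square n (H : 'M[F]_n) : psdmx H -> exists R : 'M[F]_n, H = R^t* *m R.
Proof.
move=> psdH; have [Hherm _] := psdH.
have /hermitian_normalmx/orthomx_spectralP HE : H \is hermsymmx.
  by apply/is_hermitianmxP; rewrite expr0 scale1r Hherm.
set P := spectralmx H in HE; set D := spectral_diag H in HE.
have Punit : P \in unitmx := spectral_unit H.
rewrite (invmx_unitary (spectral_unitarymx H)) -/P in HE.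
have PV : P *m P^t* = 1%:M by apply/unitarymxP/spectral_unitarymx.
have PHP : (P^t* )^t* *m H *m P^t* = diag_mx D.
  by rewrite trmxCK HE !mulmxA PV mul1mx -mulmxA PV mulmx1.
have D_ge0 j : 0 <= D 0 j.
  have [_ /(_ (delta_mx j 0))] := psdmx_congr (P^t* ) psdH.
  rewrite PHP trmx_delta map_delta_mx -rowE -colE.
  by rewrite !mxE eqxx mulr1n.
pose rootD := diag_mx (\row_j sqrtC (D 0 j)).
have rootD_herm : rootD^t* = rootD.
  rewrite tr_diag_mx map_diag_mx; congr diag_mx; apply/rowP => j.
  by rewrite !mxE; apply: geC0_conj; rewrite sqrtC_ge0.
exists (rootD *m P); rewrite trmxC_mul rootD_herm mulmxA -(mulmxA _ rootD rootD).
suff -> : rootD *m rootD = diag_mx D by [].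
by rewrite mulmx_diag; congr diag_mx; apply/rowP => j; rewrite !mxE -expr2 sqrtCK.
Qed.

Lemma psdmx_rank_factorization n (H : 'M[F]_n) : psdmx H ->
  exists p (R : 'M[F]_(p, n)), row_free R /\ H = R^t* *m R.
Proof.
move=> psdH; have [Hherm _] := psdH.
pose Q := pinvmx H *m col_base H; have QH : H *m (Q *m row_base H) = H.
  by rewrite -[Q *m _]mulmxA mulmx_base mulmxA mulmxKpV.
have /(congr1 (fun X => X^t* )) := QH.
rewrite trmxC_mul Hherm => QH'.
have HE : H = (row_base H)^t* *m (Q^t* *m H *m Q) *m row_base H.
  by rewrite -[LHS]QH -[X in X *m _]QH' trmxC_mul !mulmxA.
have [T TE] := psdmx_square (psdmx_congr Q psdH).
exists (\rank H), (T *m row_base H); split; last by rewrite trmxC_mul {1}HE TE !mulmxA.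
rewrite /row_free eqn_leq rank_leq_row; rewrite {1}HE TE -!mulmxA.
by apply: leq_trans (mxrankM_maxr _ _) _; rewrite mxrankM_maxr.
Qed.

End PositiveMatrices.

(** * Matrices over algebras *)

Notation alg_mx Q := (map_mx (in_alg _) Q).

Section ScalarMatrices.
Variables (R : comNzRingType) (A B : algType R).

Lemma map_linear_alg_mxr m n p (f : {linear A -> B}) (u : 'M[A]_(m, n))
    (Q : 'M[R]_(n, p)) :
  map_mx f (u *m alg_mx Q) = map_mx f u *m alg_mx Q.
Proof.
apply/matrixP => i j; rewrite !mxE raddf_sum; apply: eq_bigr => k _ /=.
by rewrite !mxE !mulr_algr linearZ.
Qed.

Lemma map_scalar_alg_mxl m n p (f : {scalar A}) (Q : 'M[R]_(m, n)) (u : 'M[A]_(n, p)) :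
  map_mx f (alg_mx Q *m u) = Q *m map_mx f u.
Proof.
apply/matrixP => i j; rewrite !mxE raddf_sum; apply: eq_bigr => k _ /=.
by rewrite !mxE mulr_algl linearZ.
Qed.

Lemma map_scalar_alg_mxr m n p (f : {scalar A}) (u : 'M[A]_(m, n)) (Q : 'M[R]_(n, p)) :
  map_mx f (u *m alg_mx Q) = map_mx f u *m Q.
Proof.
apply/matrixP => i j; rewrite !mxE raddf_sum; apply: eq_bigr => k _ /=.
by rewrite !mxE mulr_algr linearZ /= mulrC.
Qed.

Lemma map_scalar_mx1 n (f : {scalar A}) : map_mx f 1%:M = (f 1)%:M :> 'M_n.
Proof. by apply/matrixP => i j; rewrite !mxE raddfMn. Qed.

Lemma subspace_alg_mulmx (P : set A) m n p q (X : 'M[R]_(m, n)) (u : 'M[A]_(n, p))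
    (Y : 'M[R]_(p, q)) :
  subspace P -> (forall i j, P (u i j)) ->
  forall i j, P ((alg_mx X *m u *m alg_mx Y) i j).
Proof.
move=> subP Pu i j; rewrite mxE; apply: (subspace_sum subP) => k _.
rewrite mxE mulr_suml; apply: (subspace_sum subP) => l _.
by rewrite !mxE mulr_algl mulr_algr; do 2!apply: (subspaceZ subP).
Qed.

End ScalarMatrices.

Lemma map_scalar_inj (F : fieldType) (V : lmodType F) m n (u v : 'M[V]_(m, n)) :
  (forall f : {scalar V}, map_mx f u = map_mx f v) -> u = v.
Proof.
move=> uv; apply/matrixP => i j; apply: functional_ext => f.
by have /matrixP/(_ i j) := uv f; rewrite !mxE.
Qed.

Lemma right_invertible_mx_gt0 (R : pzRingType) m n (x : 'M[R]_(m, n)) (y : 'M[R]_(n, m)) :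
  1 != 0 :> R -> (0 < m)%N -> x *m y = 1%:M -> (0 < n)%N.
Proof.
case: n x y => // x y nz m_gt0 /matrixP/(_ (Ordinal m_gt0) (Ordinal m_gt0)) /eqP.
by rewrite !mxE big_ord0 eqxx eq_sym (negPf nz).
Qed.

Section BasisChange.
Variables (R : comUnitRingType) (A : algType R).

Lemma alg_mulVmx n (Q : 'M[R]_n) : Q \in unitmx ->
  alg_mx (invmx Q) *m alg_mx Q = 1%:M :> 'M[A]_n.
Proof. by move=> Qunit; rewrite -map_mxM mulVmx // map_mx1. Qed.

Lemma alg_mulmxV n (Q : 'M[R]_n) : Q \in unitmx ->
  alg_mx Q *m alg_mx (invmx Q) = 1%:M :> 'M[A]_n.
Proof. by move=> Qunit; rewrite -map_mxM mulmxV // map_mx1. Qed.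

Definition basis_change n (Q : 'M[R]_n) (u : 'M[A]_n) : 'M[A]_n :=
  alg_mx (invmx Q) *m u *m alg_mx Q.

Lemma basis_changeK n (Q : 'M[R]_n) (u : 'M[A]_n) : Q \in unitmx ->
  alg_mx Q *m basis_change Q u *m alg_mx (invmx Q) = u.
Proof.
by move=> Qunit; rewrite !mulmxA alg_mulmxV // mul1mx -mulmxA alg_mulmxV // mulmx1.
Qed.

Lemma map_basis_change (f : {scalar A}) n (Q : 'M[R]_n) (u : 'M[A]_n) :
  map_mx f (basis_change Q u) = invmx Q *m map_mx f u *m Q.
Proof. by rewrite map_scalar_alg_mxr map_scalar_alg_mxl. Qed.

End BasisChange.

Section StarMatrices.
Local Open Scope sesquilinear_scope.
Variables (B : algType C) (st : B -> B).
Hypothesis star_st : star_structure st.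

Definition star_mx m n (x : 'M[B]_(m, n)) : 'M[B]_(n, m) := \matrix_(i, j) st (x j i).

Definition unitary_mx m n (x : 'M[B]_(m, n)) : Prop :=
  star_mx x *m x = 1%:M /\ x *m star_mx x = 1%:M.

Lemma unitary_mx_relations m n (x : 'M[B]_(m, n)) : unitary_mx x ->
  (forall j k, \sum_i st (x i j) * x i k = (j == k)%:R) /\
  (forall i k, \sum_j x i j * st (x k j) = (i == k)%:R).
Proof.
move=> [xx' x'x]; split=> [j k|i k].
  have /matrixP/(_ j k) := xx'; rewrite !mxE => <-.
  by apply: eq_bigr => i _; rewrite mxE.
have /matrixP/(_ i k) := x'x; rewrite !mxE => <-.
by apply: eq_bigr => j _; rewrite mxE.
Qed.

Lemma star0 : st 0 = 0.
Proof.
by have [_ _ stZ _] := star_st; rewrite -{1}(scale0r (0 : B)) stZ conjC0 scale0r.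
Qed.

Lemma star1 : st 1 = 1.
Proof.
by have [stK _ _ stM] := star_st; rewrite -[LHS]mulr1 -{2}[1]stK -stM mulr1 stK.
Qed.

Lemma star_sum (J : Type) (s : seq J) (E : J -> B) :
  st (\sum_(j <- s) E j) = \sum_(j <- s) st (E j).
Proof. by have [_ stD _ _] := star_st; apply: (big_morph st stD star0). Qed.

Lemma star_mxK m n (x : 'M[B]_(m, n)) : star_mx (star_mx x) = x.
Proof. by have [stK _ _ _] := star_st; apply/matrixP => i j; rewrite !mxE stK. Qed.

Lemma star_mxM m n p (x : 'M[B]_(m, n)) (y : 'M[B]_(n, p)) :
  star_mx (x *m y) = star_mx y *m star_mx x.
Proof.
have [_ _ _ stM] := star_st; apply/matrixP => i j; rewrite !mxE star_sum.
by apply: eq_bigr => k _; rewrite stM !mxE.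
Qed.

Lemma star_alg_mx m n (Q : 'M[C]_(m, n)) : star_mx (alg_mx Q) = alg_mx (Q^t* ).
Proof.
by have [_ _ stZ _] := star_st; apply/matrixP => i j; rewrite !mxE stZ star1.
Qed.

Lemma star_mx0 m n : star_mx 0 = 0 :> 'M[B]_(m, n).
Proof. by apply/matrixP => i j; rewrite !mxE star0. Qed.

Lemma star_mx1 n : star_mx 1%:M = 1%:M :> 'M[B]_n.
Proof. by rewrite -[in LHS](map_mx1 (in_alg B)) star_alg_mx trmx1 !map_mx1. Qed.

Lemma star_block_mx m1 m2 n1 n2 (ul : 'M[B]_(m1, n1)) (ur : 'M_(m1, n2))
    (dl : 'M_(m2, n1)) (dr : 'M_(m2, n2)) :
  star_mx (block_mx ul ur dl dr) =
  block_mx (star_mx ul) (star_mx dl) (star_mx ur) (star_mx dr).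
Proof.
apply/matrixP => i j; rewrite mxE -(splitK i) -(splitK j).
case: (split i) => i'; case: (split j) => j' /=;
  by rewrite ?(block_mxEul, block_mxEur, block_mxEdl, block_mxEdr) mxE.
Qed.

Lemma unitary_mx_right_inverse m n (x : 'M[B]_(m, n)) (y : 'M[B]_(n, m)) :
  star_mx x *m x = 1%:M -> x *m y = 1%:M -> unitary_mx x.
Proof.
by move=> xx xy; split=> //; rewrite -[star_mx x]mulmx1 -xy !mulmxA -(mulmxA x) xx mulmx1.
Qed.

(* The error [w - w Q R] is killed by [star w], which has a left inverse. *)
Lemma unitary_mx_of_gram n p q (w : 'M[B]_(n, q)) (y : 'M[B]_(q, n))
    (R : 'M[C]_(p, q)) (Q : 'M[C]_(q, p)) :
  w *m y = 1%:M -> R *m Q = 1%:M -> star_mx w *m w = alg_mx (R^t* *m R) ->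
  unitary_mx (w *m alg_mx Q) /\ w = w *m alg_mx Q *m alg_mx R.
Proof.
move=> wy RQ ww; have wQR : w = w *m alg_mx Q *m alg_mx R.
  apply/eqP; rewrite -subr_eq0 -mulmxA -map_mxM -[X in X - _]mulmx1 -mulmxBr.
  set E := 1%:M - _; rewrite -[w *m E]mul1mx -star_mx1 -wy star_mxM -mulmxA.
  rewrite [star_mx w *m _]mulmxA ww /E -[1%:M](map_mx1 (in_alg B)) -map_mxB -map_mxM.
  by rewrite mulmxBr mulmx1 -mulmxA [R *m (_ *m _)]mulmxA RQ mul1mx subrr map_mx0 mulmx0.
split=> //; apply: (@unitary_mx_right_inverse _ _ _ (alg_mx R *m y)); last first.
  by rewrite mulmxA -wQR.
rewrite star_mxM star_alg_mx !mulmxA -(mulmxA _ _ w) ww -!map_mxM !mulmxA -trmxC_mul.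
by rewrite RQ trmx1 map_mx1 mul1mx RQ map_mx1.
Qed.

End StarMatrices.

Section CorepEquivalence.
Variable A : algType C.

Lemma corep_equivP m n (u : 'M[A]_n) (v : 'M[A]_m) :
  corep_equiv u v -> exists e : n = m, exists2 Q : 'M[C]_n,
    Q \in unitmx & v = castmx (e, e) (basis_change Q u).
Proof.
move=> [T [e rankT TE]]; exists (esym e); case: _ / e in u T rankT TE *.
have Tunit : T \in unitmx by rewrite -row_free_unit /row_free rankT.
exists (invmx T); first by rewrite unitmx_inv.
by rewrite castmx_id /basis_change invmxK TE -mulmxA alg_mulmxV // mulmx1.
Qed.

Lemma corep_equiv_basis_change n (Q : 'M[C]_n) (u : 'M[A]_n) :
  Q \in unitmx -> corep_equiv u (basis_change Q u).
Proof.
move=> Qunit; exists (invmx Q); split=> //; first by rewrite mxrank_unit ?unitmx_inv.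
by rewrite /basis_change -[RHS]mulmxA alg_mulmxV // mulmx1.
Qed.

Lemma corep_equiv_refl n (u : 'M[A]_n) : corep_equiv u u.
Proof. by exists 1%:M; rewrite mxrank1 map_mx1 mul1mx mulmx1. Qed.

Lemma corep_equiv_sym m n (u : 'M[A]_n) (v : 'M[A]_m) :
  corep_equiv u v -> corep_equiv v u.
Proof.
move=> /corep_equivP[e [Q Qunit]]; case: _ / e in v *; rewrite castmx_id => ->.
exists Q; split=> //; first exact: mxrank_unit.
by rewrite -[in RHS](basis_changeK u Qunit) -[RHS]mulmxA alg_mulVmx // mulmx1.
Qed.

Lemma corep_equiv_trans m n p (u : 'M[A]_m) (v : 'M[A]_n) (w : 'M[A]_p) :
  corep_equiv u v -> corep_equiv v w -> corep_equiv u w.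
Proof.
move=> [T [e rankT TE]] [T' [e' rankT' TE']].
case: _ / e in u T rankT TE *; case: _ / e' in u v T T' rankT rankT' TE TE' *.
exists (T' *m T); split=> //.
  by apply: mxrank_unit; rewrite unitmx_mul -!row_free_unit /row_free rankT rankT' eqxx.
by rewrite map_mxM -mulmxA TE mulmxA TE' mulmxA.
Qed.

End CorepEquivalence.

(** * Tensors and coalgebras *)

Lemma teqP (U V : lmodType C) (s t : seq (U * V)) :
  teq s t <-> forall f : {scalar U},
    \sum_(p <- s) f p.1 *: p.2 = \sum_(p <- t) f p.1 *: p.2.
Proof.
have sumE (f : {scalar U}) (g : {scalar V}) (r : seq (U * V)) :
    g (\sum_(p <- r) f p.1 *: p.2) = \sum_(p <- r) f p.1 * g p.2.
  by rewrite raddf_sum; apply: eq_bigr => p _ /=; rewrite linearZ.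
split=> [st f | st f g]; last by rewrite -!sumE st.
by apply: functional_ext => g; rewrite !sumE; apply: st.
Qed.

Lemma teq_trans (U V : lmodType C) (s t r : seq (U * V)) :
  teq s t -> teq t r -> teq s r.
Proof. by move=> st tr f g; rewrite st tr. Qed.

(* Expanding the left legs in a finite biorthogonal basis [e] reduces the claim
   to the functional criterion for each coordinate. *)
Lemma teq_bilinear (U V W : lmodType C) (s t : seq (U * V)) (B : U -> V -> W) :
  (forall v, linear (B^~ v)) -> (forall u, linear (B u)) ->
  teq s t -> \sum_(p <- s) B p.1 p.2 = \sum_(p <- t) B p.1 p.2.
Proof.
move=> BL BR /teqP st.
have [m [e [g [_ gs _]]]] := seq_biorthogonal_basis [seq p.1 | p <- s ++ t].
have sumE (r : seq (U * V)) : {subset r <= s ++ t} ->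
    \sum_(p <- r) B p.1 p.2 = \sum_i B (e i) (\sum_(p <- r) g i p.1 *: p.2).
  move=> rst; transitivity (\sum_(p <- r) \sum_i g i p.1 *: B (e i) p.2).
    apply: eq_big_seq => p /rst pst; rewrite {1}(gs p.1) ?map_f //.
    rewrite -(linear_ofE (BL p.2)) linear_sum.
    by apply: eq_bigr => i _; rewrite linearZ /= linear_ofE.
  rewrite exchange_big; apply: eq_bigr => i _ /=.
  rewrite -(linear_ofE (BR (e i))) linear_sum.
  by apply: eq_bigr => p _; rewrite linearZ /= linear_ofE.
rewrite !sumE => [|p pt|p ps]; rewrite ?mem_cat ?ps ?pt ?orbT //.
by apply: eq_bigr => i _; rewrite st.
Qed.

Lemma teq_tmul (A B : algType C) (s s' t t' : seq (A * B)) :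
  teq s s' -> teq t t' -> teq (tmul s t) (tmul s' t').
Proof.
move=> ss' tt' f g; rewrite /tmul !big_allpairs_dep /=.
transitivity (\sum_(p <- s) \sum_(q <- t') f (p.1 * q.1) * g (p.2 * q.2)).
  apply: eq_bigr => p _.
  exact: (tt' (f \o (p.1 \*o idfun)) (g \o (p.2 \*o idfun))).
rewrite exchange_big [RHS]exchange_big; apply: eq_bigr => q _ /=.
exact: (ss' (f \o (q.1 \o* idfun)) (g \o (q.2 \o* idfun))).
Qed.

Lemma star_scalar (A : algType C) (st : A -> A) (f : {scalar A}) :
  star_structure st -> scalar (fun x => (f (st x))^*).
Proof.
move=> [_ stD stZ _] c x y.
by rewrite stD stZ linearP /= rmorphD rmorphM /= conjCK.
Qed.

Lemma teq_star (A B : algType C) (stA : A -> A) (stB : B -> B) (s t : seq (A * B)) :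
  star_structure stA -> star_structure stB -> teq s t ->
  teq [seq (stA p.1, stB p.2) | p <- s] [seq (stA p.1, stB p.2) | p <- t].
Proof.
move=> starA starB st f g; rewrite !big_map /=; apply: (can_inj conjCK).
pose f' := linear_of (star_scalar f starA); pose g' := linear_of (star_scalar g starB).
have sumE (r : seq (A * B)) : (\sum_(p <- r) f (stA p.1) * g (stB p.2))^* =
    \sum_(p <- r) f' p.1 * g' p.2.
  by rewrite rmorph_sum; apply: eq_bigr => p _; rewrite !linear_ofE rmorphM.
by rewrite !sumE; apply: st.
Qed.

Section Slices.
Variables (U V W : lmodType C) (d : U -> seq (V * W)).
Hypothesis d_linear : tlinear d.
Implicit Types (f : {scalar V}) (g : {scalar W}).

Lemma tlinear_scalar f g :
  scalar (fun x => \sum_(p <- d x) f p.1 * g p.2).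
Proof.
move=> c x y; rewrite (d_linear c x y f g) big_cat /= big_map mulr_sumr.
by congr (_ + _); apply: eq_bigr => p _; rewrite /= linearZ /= mulrA.
Qed.

Let scalar_lsum f g x :
  g (\sum_(p <- d x) f p.1 *: p.2) = \sum_(p <- d x) f p.1 * g p.2.
Proof. by rewrite raddf_sum; apply: eq_bigr => p _ /=; rewrite linearZ. Qed.

Let scalar_rsum f g x :
  f (\sum_(p <- d x) g p.2 *: p.1) = \sum_(p <- d x) f p.1 * g p.2.
Proof. by rewrite raddf_sum; apply: eq_bigr => p _ /=; rewrite linearZ /= mulrC. Qed.

Lemma lslice_linear f : linear (fun x => \sum_(p <- d x) f p.1 *: p.2).
Proof.
move=> c x y; apply: functional_ext => g.
by rewrite linearP !scalar_lsum; apply: tlinear_scalar.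
Qed.

Lemma rslice_linear g : linear (fun x => \sum_(p <- d x) g p.2 *: p.1).
Proof.
move=> c x y; apply: functional_ext => f.
by rewrite linearP !scalar_rsum; apply: tlinear_scalar.
Qed.

Definition lslice f : {linear U -> W} := linear_of (lslice_linear f).
Definition rslice g : {linear U -> V} := linear_of (rslice_linear g).

Lemma lsliceE f x : lslice f x = \sum_(p <- d x) f p.1 *: p.2.
Proof. exact: linear_ofE. Qed.

Lemma rsliceE g x : rslice g x = \sum_(p <- d x) g p.2 *: p.1.
Proof. exact: linear_ofE. Qed.

Lemma scalar_lslice f g x : g (lslice f x) = \sum_(p <- d x) f p.1 * g p.2.
Proof. by rewrite lsliceE scalar_lsum. Qed.

Lemma scalar_rslice f g x : f (rslice g x) = \sum_(p <- d x) f p.1 * g p.2.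
Proof. by rewrite rsliceE scalar_rsum. Qed.

Lemma slice_swap f g x : g (lslice f x) = f (rslice g x).
Proof. by rewrite scalar_lslice scalar_rslice. Qed.

Lemma teq_lslice x s :
  teq (d x) s <-> forall f, lslice f x = \sum_(p <- s) f p.1 *: p.2.
Proof. by rewrite teqP; split=> xs f; have := xs f; rewrite lsliceE. Qed.

End Slices.

Section Coalgebra.
Variables (A : algType C) (Delta : A -> seq (A * A)) (eps : A -> C).

Definition is_coalgebra : Prop :=
  [/\ tlinear Delta,
      forall x,
        teq3 [seq ((q.1, q.2), p.2) | p <- Delta x, q <- Delta p.1]
             [seq ((p.1, q.1), q.2) | p <- Delta x, q <- Delta p.2],
      scalar eps,
      forall x, \sum_(p <- Delta x) eps p.1 *: p.2 = x
    & forall x, \sum_(p <- Delta x) eps p.2 *: p.1 = x].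

Hypothesis coalgA : is_coalgebra.

Lemma comul_tlinear : tlinear Delta.
Proof. by case: coalgA. Qed.

Lemma counit_scalar : scalar eps.
Proof. by case: coalgA. Qed.

Definition counit : {scalar A} := linear_of counit_scalar.

Lemma counitE x : counit x = eps x.
Proof. exact: linear_ofE. Qed.

Notation rtrans := (rslice comul_tlinear).

Definition conv (f g : {scalar A}) : {scalar A} := f \o rtrans g.

Lemma convE f g x : conv f g x = \sum_(p <- Delta x) f p.1 * g p.2.
Proof. exact: scalar_rslice. Qed.

Lemma conv_counitl f : conv counit f =1 f.
Proof.
move=> x; have [_ _ _ counitl _] := coalgA; rewrite convE -[in RHS](counitl x) raddf_sum.
by apply: eq_bigr => p _; rewrite /= linearZ counitE.
Qed.

Lemma rslice_conv f g x : rtrans f (rtrans g x) = rtrans (conv f g) x.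
Proof.
have [_ coassoc _ _ _] := coalgA.
apply: functional_ext => h; rewrite -[LHS]/(conv h f (rtrans g x)) !scalar_rslice.
have := coassoc x h f g; rewrite !big_allpairs_dep /= => hfg.
under eq_bigr do rewrite scalar_rslice mulr_suml.
rewrite hfg; apply: eq_bigr => p _; rewrite scalar_rslice mulr_sumr.
by apply: eq_bigr => q _; rewrite mulrA.
Qed.

Lemma rslice_counit x : rtrans counit x = x.
Proof.
have [_ _ _ _ counitr] := coalgA; rewrite rsliceE -[RHS]counitr.
by apply: eq_bigr => p _; rewrite counitE.
Qed.

Lemma corepP n (u : 'M[A]_n) :
  is_corep Delta eps u <->
  (forall f g, map_mx (conv f g) u = map_mx f u *m map_mx g u) /\
  map_mx counit u = 1%:M.
Proof.
split=> [[uD ueps] | [uconv ueps]].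
  split=> [f g|]; last by apply/matrixP => i j; rewrite !mxE counitE ueps.
  apply/matrixP => i j; rewrite !mxE convE (uD i j f g) big_map big_enum /=.
  by apply: eq_bigr => k _; rewrite !mxE.
split=> [i j f g | i j]; last by have /matrixP/(_ i j) := ueps; rewrite !mxE counitE.
have /matrixP/(_ i j) := uconv f g; rewrite !mxE convE => ->.
by rewrite big_map big_enum; apply: eq_bigr => k _; rewrite !mxE.
Qed.

Definition translates x : set A := range (fun f => rtrans f x).

Lemma subspace_translates x : subspace (translates x).
Proof.
split=> [|c _ _ [f _ <-] [g _ <-]].
  by exists (\0 : {scalar A}); rewrite // rsliceE big1 // => p _; rewrite scale0r.
exists (linear_of (scalar_combination c f g)) => //.
rewrite !rsliceE scaler_sumr -big_split.
by apply: eq_bigr => p _; rewrite linear_ofE scalerDl scalerA.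
Qed.

Lemma translates_finite x : exists2 s : seq A,
  [set` s] `<=` translates x & translates x `<=` span [set` s].
Proof.
have [m [e [g [_ gs _]]]] := seq_biorthogonal_basis [seq p.2 | p <- Delta x].
exists [seq rtrans (g i) x | i <- enum 'I_m].
  by move=> _ /mapP[i _ ->]; exists (g i).
move=> _ [f _ <-]; set s := [seq _ | _ <- _]; have subs := subspace_span [set` s].
have -> : rtrans f x = \sum_i f (e i) *: rtrans (g i) x.
  under eq_bigr do rewrite rsliceE scaler_sumr; rewrite rsliceE exchange_big.
  apply: eq_big_seq => p pD; rewrite {1}(gs p.2) ?map_f //.
  rewrite raddf_sum scaler_suml; apply: eq_bigr => i _ /=.
  by rewrite linearZ /= mulrC scalerA.
apply: (subspace_sum subs) => i _; apply: (subspaceZ subs).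
by apply: mem_span; apply: map_f; rewrite mem_enum.
Qed.

(* The right translates of [x] span a finite-dimensional subcomodule containing [x]. *)
Lemma mem_corep_coefficients x : exists n (u : 'M[A]_n) (c : 'M[C]_n),
  is_corep Delta eps u /\ x = \sum_i \sum_j c i j *: u i j.
Proof.
have [s s_translates translates_s] := translates_finite x.
have [n [e [g [ge e_translate expand]]]] :=
  subspace_biorthogonal_basis (subspace_translates x) s_translates translates_s.
pose u := \matrix_(k, j) lslice comul_tlinear (g k) (e j).
have fu (f : {scalar A}) k j : f (u k j) = g k (rtrans f (e j)) by rewrite mxE slice_swap.
have rtrans_e (f : {scalar A}) j : rtrans f (e j) = \sum_k f (u k j) *: e k.
  under eq_bigr do rewrite fu; apply: expand.
  by have [h _ <-] := e_translate j; exists (conv f h); rewrite // -rslice_conv.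
exists n, u, (\matrix_(i, j) (g j x * eps (e i))); split.
  apply/corepP; split=> [f h|]; apply/matrixP => k j; rewrite [LHS]mxE [RHS]mxE fu.
    rewrite -rslice_conv rtrans_e linear_sum raddf_sum; apply: eq_bigr => l _ /=.
    by rewrite !linearZ /= -/(rtrans f _) -fu mulrC; congr (_ * _); rewrite [RHS]mxE.
  by rewrite rslice_counit ge.
transitivity (\sum_j g j x *: e j).
  by apply: expand; exists counit; rewrite ?rslice_counit.
rewrite exchange_big; apply: eq_bigr => j _ /=.
under eq_bigr do rewrite mxE -scalerA; rewrite -scaler_sumr.
congr (_ *: _); apply: functional_ext => h.
rewrite -[LHS]conv_counitl -[LHS]/(counit (rtrans h (e j))) rtrans_e !raddf_sum.
by apply: eq_bigr => k _; rewrite /= !linearZ /= counitE mulrC.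
Qed.

End Coalgebra.

(** * Irreducible corepresentations *)

Lemma subspace_submx (F : fieldType) n (P : set 'rV[F]_n) :
  subspace P -> exists W : 'M[F]_n, forall w, (w <= W)%MS <-> P w.
Proof.
move=> subP.
pose rank_in r := `[< exists2 W : 'M[F]_n, \rank W = r
  & forall w : 'rV_n, (w <= W)%MS -> P w >].
have rank_in0 : exists r, rank_in r.
  exists 0; apply/asboolP; exists 0; first exact: mxrank0.
  by move=> w; rewrite submx0 => /eqP ->; apply: subspace0.
have rank_in_le r : rank_in r -> (r <= n)%N.
  by move=> /asboolP[W <- _]; apply: rank_leq_col.
case: (ex_maxnP rank_in0 rank_in_le) => r /asboolP[W rankW WP] rmax.
exists W => w; split=> [/WP //|Pw].
have /rmax : rank_in (\rank (W + w)%MS).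
  apply/asboolP; exists (W + w)%MS => // x /sub_addsmxP[[x1 x2] /= ->].
  apply: (subspaceD subP); first by apply: WP; apply: submxMl.
  by rewrite (mx11_scalar x2) mul_scalar_mx; apply: subspaceZ.
rewrite -rankW => rankWw.
have /mxrank_leqif_sup[_ WwW] : (W <= W + w)%MS by apply: addsmxSl.
rewrite eqn_leq rankWw mxrankS ?addsmxSl // in WwW.
by apply: submx_trans (_ : W + w <= W)%MS; rewrite ?addsmxSr // -WwW.
Qed.

Lemma linear_relation_mx (F : fieldType) m n (G : set ('cV[F]_m * 'cV[F]_n)) :
  subspace G -> (forall x, exists y, G (x, y)) -> (forall y, G (0, y) -> y = 0) ->
  exists T : 'M[F]_(n, m), forall x y, G (x, y) -> y = T *m x.
Proof.
move=> subG totG G0.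
have /choice[e Ge] (j : 'I_m) : exists y, G (delta_mx j 0, y) by apply: totG.
exists (\matrix_(i, j) e j i 0) => x y Gxy.
have : G (\sum_j x j 0 *: (delta_mx j 0, e j)).
  by apply: (subspace_sum subG) => j _; apply: (subspaceZ subG).
move=> /(subspaceB subG Gxy).
rewrite [X in (x, y) - X]surjective_pairing !raddf_sum /=.
have -> : \sum_j x j 0 *: delta_mx j 0 = x.
  by rewrite [RHS]matrix_sum_delta; apply: eq_bigr => j _; rewrite big_ord1.
move=> Gxx; apply/eqP; rewrite -subr_eq0; apply/eqP/G0; move: Gxx.
rewrite -[(x, y) - _]/(x - x, y - _) subrr; congr (G (_, y - _)).
apply/colP => i; rewrite summxE mxE; apply: eq_bigr => j _.
by rewrite !mxE mulrC.
Qed.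

Section Schur.
Variables (A : algType C) (Delta : A -> seq (A * A)) (eps : A -> C).

Lemma irr_corep_stable n (u : 'M[A]_n) (P : set 'cV[C]_n) w0 :
  irr_corep Delta eps u -> subspace P ->
  (forall (f : {scalar A}) w, P w -> P (map_mx f u *m w)) ->
  P w0 -> w0 != 0 -> forall w, P w.
Proof.
move=> [_ _ uirr] subP uP Pw0 w0_neq0 w.
have subPT : subspace [set x : 'rV_n | P x^T].
  split=> [|c x y]; rewrite /= ?trmx0; first exact: subspace0.
  by rewrite linearP; apply: subP.2.
have [W WP] := subspace_submx subPT.
have [f| /eqP | rankW] := uirr W; last first.
- by rewrite -[w]trmxK; apply/WP/submx_full; rewrite /row_full rankW.
- rewrite mxrank_eq0 => /eqP W0.
  have /WP : P w0^T^T by rewrite trmxK.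
  by rewrite W0 submx0 trmx_eq0 (negPf w0_neq0).
- apply/row_subP => i; rewrite row_mul; apply/WP; rewrite /= trmx_mul trmxK.
  by apply/uP/WP/row_sub.
Qed.

Lemma schur m n (u : 'M[A]_n) (v : 'M[A]_m) (T : 'M[C]_(m, n)) :
  irr_corep Delta eps u -> irr_corep Delta eps v ->
  alg_mx T *m u = v *m alg_mx T ->
  T = 0 \/ m = n /\ \rank T = n.
Proof.
move=> [_ _ uirr] [_ _ virr] Tuv.
have Tf (f : {scalar A}) : (map_mx f u)^T *m T^T = T^T *m (map_mx f v)^T.
  by rewrite -!trmx_mul -map_scalar_alg_mxl Tuv map_scalar_alg_mxr.
have [f||rank_im] := virr <<T^T>>%MS.
- by rewrite !genmxE (eqmxMr _ (genmxE T^T)) -Tf; apply: submxMl.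
- by rewrite mxrank_gen mxrank_tr => /eqP; rewrite mxrank_eq0 => /eqP; left.
rewrite mxrank_gen in rank_im.
have [f|rank_ker|rank_ker] := uirr (kermx T^T).
- by apply/sub_kermxP; rewrite -mulmxA Tf mulmxA mulmx_ker mul0mx.
- right; have rankT : \rank T^T = n.
    by apply/eqP; rewrite eqn_leq rank_leq_row -subn_eq0 -mxrank_ker rank_ker.
  by split; [rewrite -rank_im | rewrite -mxrank_tr].
- left; apply: trmx_inj; rewrite trmx0 -[LHS]mul1mx; apply/sub_kermxP.
  by rewrite sub1mx; apply/eqP.
Qed.

Lemma schur_scalar n (u : 'M[A]_n) (T : 'M[C]_n) :
  irr_corep Delta eps u -> alg_mx T *m u = u *m alg_mx T ->
  exists d : C, T = d%:M.
Proof.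
move=> uirr Tu; have [_ n_gt0 _] := uirr.
have [d] := eigenvalue_closed T n_gt0; rewrite /eigenvalue kermx_eq0 => Td_singular.
exists d; apply/eqP; rewrite -subr_eq0; apply/eqP.
have [|//|[_ /eqP rankTd]] := @schur _ _ _ _ (T - d%:M) uirr uirr; last first.
  by rewrite /row_free rankTd in Td_singular.
apply: map_scalar_inj => f; rewrite map_scalar_alg_mxl map_scalar_alg_mxr.
by rewrite mulmxBl mulmxBr scalar_mxC -map_scalar_alg_mxl Tu map_scalar_alg_mxr.
Qed.

End Schur.

Section Density.
Variables (A : algType C) (Delta : A -> seq (A * A)) (eps : A -> C).
Hypothesis coalgA : is_coalgebra Delta eps.
Variables (I : eqType) (n : I -> nat) (a : forall l, 'M[A]_(n l)).
Hypothesis a_irr : forall l, irr_corep Delta eps (a l).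
Hypothesis a_inequiv : forall l l', l <> l' -> ~ corep_equiv (a l) (a l').

Notation conv := (conv coalgA).

Definition col_at l (w : 'cV[C]_(n l)) : {l : I & 'cV[C]_(n l)} := Tagged _ w.

Definition kills (g : {scalar A}) (x : {l : I & 'cV[C]_(n l)}) : Prop :=
  map_mx g (a (tag x)) *m tagged x = 0.

Lemma map_conv l f g :
  map_mx (conv f g) (a l) = map_mx f (a l) *m map_mx g (a l).
Proof. by have [/(corepP coalgA)[aconv _] _ _] := a_irr l; apply: aconv. Qed.

Lemma map_counit l : map_mx (counit coalgA) (a l) = 1%:M.
Proof. by have [/(corepP coalgA)[_ aeps] _ _] := a_irr l. Qed.

Definition vectors_at (L : seq {l : I & 'cV[C]_(n l)}) l : set 'cV[C]_(n l) :=
  [set w | col_at w \in L].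

Section Annihilator.
Variable L : seq {l : I & 'cV[C]_(n l)}.

Definition annihilates (g : {scalar A}) : Prop := {in L, forall x, kills g x}.

Lemma annihilates_conv f g : annihilates g -> annihilates (conv f g).
Proof.
by move=> Lg x /Lg gx; rewrite /kills map_conv -mulmxA [_ *m tagged x]gx mulmx0.
Qed.

Definition joint_orbit l1 (w1 : 'cV[C]_(n l1)) l0 (w0 : 'cV[C]_(n l0)) :=
  [set (map_mx g (a l1) *m w1, map_mx g (a l0) *m w0) | g in annihilates].

Lemma subspace_joint_orbit l1 (w1 : 'cV[C]_(n l1)) l0 (w0 : 'cV[C]_(n l0)) :
  subspace (joint_orbit w1 w0).
Proof.
have map_null l : map_mx (\0 : {scalar A}) (a l) = 0.
  by apply/matrixP => i j; rewrite !mxE.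
split=> [|c _ _ [f Lf <-] [g Lg <-]].
  by exists (\0 : {scalar A}) => [x _|]; rewrite /kills !map_null !mul0mx.
pose h := linear_of (scalar_combination c f g).
have map_h l : map_mx h (a l) = c *: map_mx f (a l) + map_mx g (a l).
  by apply/matrixP => i j; rewrite !mxE linear_ofE.
exists h => [x xL|]; rewrite /kills !map_h !mulmxDl -!scalemxAl //.
by rewrite [_ *m tagged x]Lf // [_ *m tagged x]Lg // scaler0 addr0.
Qed.

Lemma annihilator_transitive l1 (w1 : 'cV[C]_(n l1)) g1 :
  annihilates g1 -> ~ kills g1 (col_at w1) ->
  forall w, exists2 g, annihilates g & map_mx g (a l1) *m w1 = w.
Proof.
move=> Lg1 /eqP g1w1 w.
pose P := [set w | joint_orbit w1 w1 (w, w)].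
have subP : subspace P.
  have subO := subspace_joint_orbit w1 w1.
  by split=> [|c x y]; [apply: subO.1 | apply: subO.2].
have [||g Lg [gw1 _]] := irr_corep_stable (a_irr l1) subP _ _ g1w1 w; last by exists g.
  move=> f _ [g Lg [<- _]]; exists (conv f g); first exact: annihilates_conv.
  by rewrite map_conv mulmxA.
by exists g1.
Qed.

(* The joint orbit of [w1] and [w0] is the graph of [T]. *)
Lemma joint_orbit_intertwiner l1 (w1 : 'cV[C]_(n l1)) l0 (w0 : 'cV[C]_(n l0)) g1 :
  annihilates g1 -> ~ kills g1 (col_at w1) ->
  (forall g, annihilates g -> kills g (col_at w1) -> kills g (col_at w0)) ->
  exists2 T : 'M[C]_(n l0, n l1), alg_mx T *m a l1 = a l0 *m alg_mx T
    & forall g, annihilates g -> map_mx g (a l0) *m w0 = T *m (map_mx g (a l1) *m w1).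
Proof.
move=> Lg1 g1w1 kills_w0; have full := annihilator_transitive Lg1 g1w1.
have [|x|y [g Lg [gw1 gw0]]|T TP] := linear_relation_mx (G := joint_orbit w1 w0).
- exact: subspace_joint_orbit.
- by have [g Lg gw1] := full x; exists (map_mx g (a l0) *m w0), g; rewrite ?gw1.
- by rewrite -gw0; apply: kills_w0 gw1.
have Tw g : annihilates g -> map_mx g (a l0) *m w0 = T *m (map_mx g (a l1) *m w1).
  by move=> Lg; apply: TP; exists g.
exists T => //; apply: map_scalar_inj => f; rewrite map_scalar_alg_mxl map_scalar_alg_mxr.
apply/trmx_inj/row_matrixP => i; apply: trmx_inj; rewrite !tr_row !trmxK !colE -!mulmxA.
have [g Lg <-] := full (delta_mx i 0).
by rewrite -Tw // !(mulmxA (map_mx f _)) -!map_conv Tw //; apply: annihilates_conv.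
Qed.

End Annihilator.

(* Jacobson's density theorem for the pairwise inequivalent simple modules
   given by the [a l] over the convolution algebra of functionals on [A]. *)
Lemma density (L : seq {l : I & 'cV[C]_(n l)}) l0 (w0 : 'cV[C]_(n l0)) :
  (forall g, annihilates L g -> kills g (col_at w0)) ->
  span (@vectors_at L l0) w0.
Proof.
elim: L l0 w0 => [|x1 L IHL] l0 w0 kills_w0.
  have := kills_w0 (counit coalgA); rewrite /kills map_counit mul1mx /= => -> //.
  exact: subspace0 (subspace_span _).
have span_cons l (w : 'cV[C]_(n l)) :
    span (@vectors_at L l) w -> span (@vectors_at (x1 :: L) l) w.
  apply: sub_smallest2r; first exact: subspace_span.
  by move=> v vL; rewrite /vectors_at /= inE [_ \in L]vL orbT.
have [Lx1|] := pselect (forall g, annihilates L g -> kills g x1).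
  apply: span_cons; apply: IHL => g Lg; apply: kills_w0 => x.
  by rewrite inE => /predU1P[->|/Lg //]; apply: Lx1.
case: x1 => l1 w1 in kills_w0 span_cons *.
move=> /existsNP[g1 /not_implyP[Lg1 g1w1]].
have [|T Ta Tw] := joint_orbit_intertwiner (w0 := w0) Lg1 g1w1.
  move=> g Lg gw1; apply: kills_w0 => x.
  by rewrite inE => /predU1P[->|/Lg //].
have [l10|/eqP l10] := eqVneq l1 l0; last first.
  have [T0|[e rankT]] := schur (a_irr l1) (a_irr l0) Ta.
    by apply: span_cons; apply: IHL => g Lg; rewrite /kills /= Tw // T0 mul0mx.
  by case: (a_inequiv l10); exists T.
case: _ / l10 in w0 kills_w0 T Ta Tw *.
have [d Td] := schur_scalar (a_irr l1) Ta.
have [_ spanD] := subspace_span (@vectors_at (col_at w1 :: L) l1).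
rewrite -[w0](subrK (d *: w1)) addrC; apply: spanD.
  by apply: mem_span; rewrite /vectors_at /= inE eqxx.
apply: span_cons; apply: IHL => g Lg.
by rewrite /kills /= mulmxBr Tw // Td mul_scalar_mx scalemxAr subrr.
Qed.

End Density.

Section Entries.
Variables (V : Type) (I : eqType) (n p : I -> nat) (z : forall l, 'M[V]_(n l, p l)).

Definition entry_index : eqType := {l : I & ('I_(n l) * 'I_(p l))%type}.

Definition index_of l (i : 'I_(n l)) (j : 'I_(p l)) : entry_index := Tagged _ (i, j).

Definition entries (x : entry_index) : V := z (projT1 x) (projT2 x).1 (projT2 x).2.

End Entries.

Section MatrixCoefficients.
Variables (A : algType C) (Delta : A -> seq (A * A)) (eps : A -> C).
Hypothesis coalgA : is_coalgebra Delta eps.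
Variables (I : eqType) (n : I -> nat) (a : forall l, 'M[A]_(n l)).
Hypothesis a_irr : forall l, irr_corep Delta eps (a l).
Hypothesis a_inequiv : forall l l', l <> l' -> ~ corep_equiv (a l) (a l').

Lemma separating_column (s : seq {l : I & 'I_(n l)}) l0 (k0 : 'I_(n l0))
    (w : 'cV[C]_(n l0)) :
  Tagged _ k0 \notin s ->
  exists2 g : {scalar A}, col k0 (map_mx g (a l0)) = w
    & {in s, forall x, col (tagged x) (map_mx g (a (tag x))) = 0}.
Proof.
move=> k0s; pose unit_at (x : {l : I & 'I_(n l)}) := col_at (delta_mx (tagged x) 0).
have [g1 Lg1 g1k0] : exists2 g, annihilates a (map unit_at s) g
    & ~ kills a g (unit_at (Tagged _ k0)).
  apply: contrapT => no_g.
  have /(smallest_sub _ (X := [set w : 'cV[C]_(n l0) | w k0 0 = 0])) :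
      span (@vectors_at _ _ (map unit_at s) l0) (delta_mx k0 0).
    apply: (density coalgA a_irr a_inequiv) => g Lg.
    by apply: contrapT => gk0; apply: no_g; exists g.
  rewrite /= mxE !eqxx => e0; suff /eqP : (1 : C) = 0 by rewrite oner_eq0.
  apply: e0 => [|v /mapP[[l k] ks] vE].
    by split=> [|c x y /= x0 y0]; rewrite /= !mxE // x0 y0 mulr0 addr0.
  have l0l : l0 = l by have /(congr1 tag) := vE.
  case: _ / l0l in k ks vE *; move: vE => /eqP; rewrite eq_Tagged /= => /eqP ->.
  by rewrite mxE eqxx andbT; case: eqP ks k0s => // -> ->.
have [g Lg gw] := annihilator_transitive coalgA a_irr Lg1 g1k0 w.
exists g => [|x xs]; first by rewrite colE.
by rewrite colE; apply: (Lg (unit_at x)); apply: map_f.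
Qed.

Lemma entries_biorthogonal :
  exists G : entry_index n n -> {scalar A}, biorthogonal G (entries a).
Proof.
apply: finitely_separated_biorthogonal => -[l0 [i0 k0]] s j0s.
pose column (j : entry_index n n) := Tagged (fun l => 'I_(n l)) (tagged j).2.
pose s' := [seq column j | j <- s & column j != column (index_of i0 k0)].
have [|g gk0 gs'] := @separating_column s' l0 k0 (delta_mx i0 0).
  by apply/negP => /mapP[j]; rewrite mem_filter => /andP[/eqP jk0 _] /esym.
have gE i : g (a l0 i k0) = (i == i0)%:R.
  by have /colP/(_ i) := gk0; rewrite !mxE eqxx andbT.
exists g => [|[l [i k]] js]; first by rewrite /entries /= gE eqxx.
have [kk0|kk0] := eqVneq (column (index_of i k)) (column (index_of i0 k0)).
  have l0l : l0 = l by have /esym/(congr1 tag) := kk0.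
  case: _ / l0l in i k kk0 js *; move/eqP: kk0; rewrite eq_Tagged /= => /eqP kk0.
  rewrite /entries /= kk0 gE; case: eqP => // ii0.
  by rewrite -ii0 -kk0 js in j0s.
have /gs' /= /colP/(_ i) : column (index_of i k) \in s'.
  by apply: map_f; rewrite mem_filter kk0.
by rewrite !mxE.
Qed.

End MatrixCoefficients.

(** * Unitarizable Hopf star-algebras *)

Section Hopf.
Local Open Scope sesquilinear_scope.
Variables (A : algType C) (Delta : A -> seq (A * A)) (eps : A -> C).
Variables (S : A -> A) (stA : A -> A).
Hypothesis hopfA : is_hopf_star_algebra Delta eps S stA.
Hypothesis unitA : unitarizable Delta eps stA.

Lemma hopf_coalgebra : is_coalgebra Delta eps.
Proof. by have [[? _ _ ?] [? _ _ ? ?] _ _ _] := hopfA. Qed.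

Lemma hopf_star : star_structure stA.
Proof. by case: hopfA. Qed.

Notation is_corep := (is_corep Delta eps).

Lemma antipode_corep n (u : 'M[A]_n) : is_corep u ->
  map_mx S u *m u = 1%:M /\ u *m map_mx S u = 1%:M.
Proof.
move=> [uD ueps]; have [_ _ [S_linear Sl Sr] _ _] := hopfA.
split; apply/matrixP => i j; rewrite !mxE.
  have := teq_bilinear (B := fun x y => S x * y) _ _ (uD i j).
  rewrite Sl big_map big_enum ueps /= scaler_nat => ->.
  - by apply: eq_bigr => k _; rewrite !mxE.
  - by move=> y c x x'; rewrite S_linear mulrDl scalerAl.
  - by move=> x c y y'; rewrite mulrDr scalerAr.
have := teq_bilinear (B := fun x y => x * S y) _ _ (uD i j).
rewrite Sr big_map big_enum ueps /= scaler_nat => ->.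
- by apply: eq_bigr => k _; rewrite !mxE.
- by move=> y c x x'; rewrite mulrDl scalerAl.
- by move=> x c y y'; rewrite S_linear mulrDr scalerAr.
Qed.

Lemma corep_basis_change n (Q : 'M[C]_n) (u : 'M[A]_n) : Q \in unitmx ->
  is_corep u -> is_corep (basis_change Q u).
Proof.
move=> Qunit /(corepP hopf_coalgebra)[uconv ueps]; apply/(corepP hopf_coalgebra).
split=> [f g|]; rewrite !map_basis_change.
  by rewrite uconv !mulmxA mulmxK.
by rewrite ueps mulmx1 mulVmx.
Qed.

Lemma irr_basis_change n (Q : 'M[C]_n) (u : 'M[A]_n) : Q \in unitmx ->
  irr_corep Delta eps u -> irr_corep Delta eps (basis_change Q u).
Proof.
move=> Qunit [u_corep n_gt0 uirr]; split=> // [|W stableW].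
  exact: corep_basis_change.
have QTunit : Q^T \in unitmx by rewrite unitmx_tr.
have := uirr (W *m Q^T); rewrite mxrankMfree ?row_free_unit //; apply=> f.
have := stableW f; rewrite map_basis_change !trmx_mul trmx_inv !mulmxA.
by move=> /(submxMr Q^T); rewrite mulmxKV.
Qed.

Lemma invariant_form n (u : 'M[A]_n) : is_corep u ->
  exists2 H : 'M[C]_n, posdefmx H & star_mx stA u *m alg_mx H *m u = alg_mx H.
Proof.
move=> /unitA[H [Hherm Hpos uH]]; exists H.
  split=> [|v /Hpos]; last by rewrite map_trmx.
  by apply/matrixP => i j; rewrite !mxE; apply/esym/Hherm.
apply/matrixP => j m; rewrite [RHS]mxE /= -uH mxE exchange_big; apply: eq_bigr => k _ /=.
rewrite !mxE mulr_suml; apply: eq_bigr => i _; rewrite !mxE.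
by rewrite mulr_algr scalerAl.
Qed.

Lemma unitarization n (u : 'M[A]_n) : is_corep u ->
  exists2 Q, Q \in unitmx & unitary_mx stA (basis_change Q u).
Proof.
move=> u_corep; have [H Hpos uH] := invariant_form u_corep.
have [R HE] := psdmx_square (posdef_psdmx Hpos).
have Runit : R \in unitmx.
  by have := posdef_unitmx Hpos; rewrite HE unitmx_mul => /andP[].
have Qunit : invmx R \in unitmx by rewrite unitmx_inv.
exists (invmx R) => //.
have [_ uS] := antipode_corep (corep_basis_change Qunit u_corep).
apply: unitary_mx_right_inverse uS.
rewrite /basis_change invmxK !(star_mxM hopf_star) !(star_alg_mx hopf_star).
rewrite mulmxA -(mulmxA _ _ (alg_mx (R^t* ))) -2!mulmxA (mulmxA _ (alg_mx R)).
rewrite -(mulmxA _ _ (alg_mx R)) -map_mxM -HE !mulmxA -(mulmxA _ (star_mx stA u)).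
rewrite -(mulmxA _ _ u) uH -!map_mxM HE mulmxA -trmxC_mul mulmxV //.
by rewrite trmx1 map_mx1 mul1mx mulmxV // map_mx1.
Qed.

Lemma corep_diag_blocks r s (b : 'M[A]_r) (c : 'M[A]_(r, s)) (d : 'M[A]_s) :
  is_corep (block_mx b c 0 d) -> is_corep b /\ is_corep d.
Proof.
move=> /(corepP hopf_coalgebra)[vconv veps].
move: veps; rewrite map_block_mx scalar_mx_block => /eq_block_mx[beps _ _ deps].
split; apply/(corepP hopf_coalgebra); split=> // f g;
  have := vconv f g; rewrite !map_block_mx mulmx_block => /eq_block_mx[bconv _ _ dconv].
  by rewrite bconv map_mx0 mulmx0 addr0.
by rewrite dconv map_mx0 mul0mx add0r.
Qed.

(* With [X = P^-1 Q], where [P] and [Q] are the upper blocks of an invariant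
   form, invariance forces [c = b X - X d]. *)
Lemma triangular_corep_splits r s (b : 'M[A]_r) (c : 'M[A]_(r, s)) (d : 'M[A]_s) :
  is_corep (block_mx b c 0 d) ->
  exists X : 'M[C]_(r, s), c = b *m alg_mx X - alg_mx X *m d.
Proof.
move=> v_corep; have [b_corep _] := corep_diag_blocks v_corep.
have [H Hpos] := invariant_form v_corep.
have Punit := posdef_unitmx (posdef_ulsubmx Hpos).
rewrite -(submxK H); set P := ulsubmx H in Punit *; set Q := ursubmx H.
rewrite star_block_mx (star_mx0 hopf_star) map_block_mx.
rewrite !mulmx_block !mul0mx !addr0 !mulmx0 !addr0 => /eq_block_mx[bP bQ _ _].
have [_ bS] := antipode_corep b_corep.
have bP' : star_mx stA b *m alg_mx P = alg_mx P *m map_mx S b.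
  by rewrite -{2}bP -[RHS]mulmxA bS mulmx1.
exists (invmx P *m Q); set X := alg_mx (invmx P *m Q).
have QE : alg_mx Q = alg_mx P *m X by rewrite -map_mxM mulmxA mulmxV // mul1mx.
have SbX : map_mx S b *m (c + X *m d) = X.
  have := bQ; rewrite QE mulmxA bP' -!mulmxA -mulmxDr -mulmxDr.
  by move=> /(congr1 (mulmx (alg_mx (invmx P)))); rewrite !mulmxA alg_mulVmx // !mul1mx.
by apply/eqP; rewrite eq_sym subr_eq -{1}SbX mulmxA bS mul1mx.
Qed.

Lemma stable_subspace_triangular r s (u : 'M[A]_(r + s)) (W : 'M[C]_(r + s)) :
  \rank W = r -> (forall f : {scalar A}, (W *m (map_mx f u)^T <= W)%MS) ->
  exists2 Q, Q \in unitmx & dlsubmx (basis_change Q u) = 0.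
Proof.
move=> rankW stableW; pose E := row_ebase W.
have Eunit : E \in unitmx by apply: row_ebase_unit.
exists E^T; first by rewrite unitmx_tr.
pose pid : 'M[C]_(r, r + s) := pid_mx r.
have baseW : (pid *m E :=: W)%MS by have := eq_row_base W; rewrite /row_base -/E rankW.
apply: map_scalar_inj => f; apply: trmx_inj.
rewrite map_dlsubmx trmx_dlsub map_basis_change !trmx_mul trmx_inv trmxK mulmxA.
set F := E *m _ *m _.
have : (pid *m E *m (map_mx f u)^T <= pid *m E)%MS by rewrite baseW (eqmxMr _ baseW).
move=> /submxP[Y YE]; have : pid *m F = Y *m pid by rewrite /F !mulmxA YE mulmxA mulmxK.
rewrite /pid pid_mx_row -{1}(submxK F) mul_row_block mul_mx_row.
rewrite !mul1mx !mul0mx !addr0 mulmx0.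
by move=> /eq_row_mx[_ ->]; apply/matrixP => i j; rewrite !mxE raddf0.
Qed.

Lemma corep_reducible n (u : 'M[A]_n) : is_corep u ->
  [\/ n = 0, irr_corep Delta eps u
    | exists r s (e : (r + s)%N = n) Q,
        [/\ (0 < r)%N, (0 < s)%N, Q \in unitmx
          & dlsubmx (basis_change Q (castmx (esym e, esym e) u)) = 0]].
Proof.
move=> u_corep; have [n0|n_gt0] := posnP n; first by constructor 1.
have [[W [stableW W0 Wn]]|noW] := pselect (exists W : 'M[C]_n,
    [/\ forall f : {scalar A}, (W *m (map_mx f u)^T <= W)%MS,
        \rank W <> 0 & \rank W <> n]); last first.
  constructor 2; split=> // W stableW.
  have [|W0] := pselect (\rank W = 0); first by left.
  have [|Wn] := pselect (\rank W = n); first by right.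
  by case: noW; exists W.
constructor 3; have [r rankW] : exists r, \rank W = r by exists (\rank W).
have le_rn : (r <= n)%N by rewrite -rankW rank_leq_row.
have [s rsn] : exists s, (r + s)%N = n by exists (n - r)%N; rewrite subnKC.
case: _ / rsn in u u_corep W stableW W0 Wn rankW le_rn n_gt0 *.
have [Q Qunit Q0] := stable_subspace_triangular rankW stableW.
exists r, s, (erefl _), Q; split; rewrite ?castmx_id ?lt0n //.
  by apply/eqP; rewrite -rankW.
by apply/eqP => s0; apply: Wn; rewrite rankW s0 addn0.
Qed.

Lemma corep_coefficients_in (P : set A) : subspace P ->
  (forall m (v : 'M[A]_m), irr_corep Delta eps v -> forall i j, P (v i j)) ->
  forall n (u : 'M[A]_n), is_corep u -> forall i j, P (u i j).
Proof.
move=> subP Pirr n; have [N] := ubnP n; elim: N n => // N IHN n.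
rewrite ltnS => le_nN u u_corep; have [n0|uirr|] := corep_reducible u_corep.
- by move: (u); rewrite n0 => ? [].
- exact: Pirr uirr.
move=> [r [s [e [Q [r_gt0 s_gt0 Qunit dl0]]]]].
case: _ / e in u u_corep dl0 le_nN *; rewrite castmx_id in dl0.
set v := basis_change Q u in dl0.
have vE : block_mx (ulsubmx v) (ursubmx v) 0 (drsubmx v) = v by rewrite -dl0 submxK.
have v_corep : is_corep v by apply: corep_basis_change.
rewrite -vE in v_corep; have [X cE] := triangular_corep_splits v_corep.
have [b_corep d_corep] := corep_diag_blocks v_corep.
have Pb : forall i j, P (ulsubmx v i j).
  by apply: IHN b_corep; apply: leq_trans le_nN; rewrite -addn1 leq_add2l.
have Pd : forall i j, P (drsubmx v i j).
  by apply: IHN d_corep; apply: leq_trans le_nN; rewrite -add1n leq_add2r.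
have alg1 m : alg_mx 1%:M = 1%:M :> 'M[A]_m by rewrite map_mx1.
rewrite -(basis_changeK u Qunit) -/v; apply: subspace_alg_mulmx => // i j.
rewrite -vE -(splitK i) -(splitK j); case: (split i) => i'; case: (split j) => j' /=.
- by rewrite block_mxEul.
- rewrite block_mxEur cE mxE [X in _ + X]mxE; apply: (subspaceB subP).
    by rewrite -[ulsubmx v]mul1mx -alg1; apply: subspace_alg_mulmx.
  by rewrite -[_ *m drsubmx v]mulmx1 -alg1; apply: subspace_alg_mulmx.
- by rewrite block_mxEdl mxE; apply: subspace0.
- by rewrite block_mxEdr.
Qed.

End Hopf.

Definition irr_representatives (A : algType C) (Delta : A -> seq (A * A)) (eps : A -> C)
    (I : Type) (n : I -> nat) (a : forall l, 'M[A]_(n l)) : Prop :=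
  [/\ forall l, irr_corep Delta eps (a l),
      forall l l', l <> l' -> ~ corep_equiv (a l) (a l')
    & forall m (u : 'M[A]_m), irr_corep Delta eps u -> exists l, corep_equiv u (a l)].

Section Representatives.
Variables (A : algType C) (Delta : A -> seq (A * A)) (eps : A -> C).
Variables (S : A -> A) (stA : A -> A).
Hypothesis hopfA : is_hopf_star_algebra Delta eps S stA.
Hypothesis unitA : unitarizable Delta eps stA.

Local Open Scope quotient_scope.

Lemma unitary_representatives :
  exists (I : eqType) (n : I -> nat) (a : forall l : I, 'M[A]_(n l)),
    irr_representatives Delta eps a /\ forall l, unitary_mx stA (a l).
Proof.
pose U := {classic {m : nat & {u : 'M[A]_m | irr_corep Delta eps u /\ unitary_mx stA u}}}.
pose mx (x : U) : 'M[A]_(projT1 x) := sval (projT2 x).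
pose equiv (x y : U) := `[< corep_equiv (mx x) (mx y) >].
have equiv_refl : reflexive equiv by move=> x; apply/asboolP/corep_equiv_refl.
have equiv_sym : symmetric equiv.
  by move=> x y; apply: asbool_equiv_eq; split; apply: corep_equiv_sym.
have equiv_trans : transitive equiv.
  by move=> y x z /asboolP xy /asboolP yz; apply/asboolP; apply: corep_equiv_trans yz.
pose E := EquivRel equiv equiv_refl equiv_sym equiv_trans.
exists {eq_quot E}, (fun l => projT1 (repr l)), (fun l => mx (repr l)); split.
  split=> [l|l l' ll' rr'|m u uirr].
  - by have [] := svalP (projT2 (repr l)).
  - by apply: ll'; rewrite -[l]reprK -[l']reprK; apply/eqquotP/asboolP.
  - have [u_corep _ _] := uirr; have [Q Qunit Quu] := unitarization hopfA unitA u_corep.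
    pose x : U := existT _ m (exist _ _ (conj (irr_basis_change hopfA Qunit uirr) Quu)).
    exists (\pi_{eq_quot E} x).
    apply: corep_equiv_trans (corep_equiv_basis_change _ Qunit) _.
    suff /eqquotP/asboolP : x = repr (\pi_{eq_quot E} x) %[mod {eq_quot E}] by [].
    by rewrite reprK.
by move=> l; have [] := svalP (projT2 (repr l)).
Qed.

Lemma entries_spanning (I : eqType) (n : I -> nat) (a : forall l : I, 'M[A]_(n l)) :
  irr_representatives Delta eps a -> forall x, span (range (entries a)) x.
Proof.
move=> [_ _ a_complete] x; have subs := subspace_span (range (entries a)).
have [m [u [c [u_corep ->]]]] := mem_corep_coefficients (hopf_coalgebra hopfA) x.
apply: (subspace_sum subs) => i _; apply: (subspace_sum subs) => j _.
apply: (subspaceZ subs).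
apply: (corep_coefficients_in hopfA unitA subs) u_corep i j => k v /a_complete[l].
move=> /corep_equiv_sym/corep_equivP[e [Q Qunit]].
case: _ / e in v *; rewrite castmx_id => ->.
apply: subspace_alg_mulmx => // i j; apply: mem_span; by exists (index_of i j).
Qed.

End Representatives.

(** * Galois extensions *)

Section BasisFamily.
Variables (V : lmodType C) (J : eqType) (x : J -> V) (g : J -> {scalar V}).
Hypothesis gx : biorthogonal g x.

Lemma biorthogonal_free : free_family x.
Proof.
move=> m f c f_inj cx0 k; have := congr1 (g (f k)) cx0.
rewrite raddf0 raddf_sum (bigD1 k) //= linearZ /= gx eqxx mulr1 big1 ?addr0 // => i ik.
by rewrite linearZ /= gx (inj_eq f_inj) eq_sym (negPf ik) mulr0.
Qed.

Lemma biorthogonal_basis : (forall v, span (range x) v) -> basis_family x.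
Proof.
move=> spanx; split=> [|v]; first exact: biorthogonal_free.
by have [m [f [c [_ ->]]]] := span_imageP (spanx v); exists m, f, c.
Qed.

End BasisFamily.

Section GaloisExtension.
Local Open Scope sesquilinear_scope.
Variables (A : algType C) (Delta : A -> seq (A * A)) (eps : A -> C) (S : A -> A).
Variables (stA : A -> A).
Variables (Z : algType C) (stZ : Z -> Z) (alpha : Z -> seq (A * Z)) (mu : Z -> C).
Hypothesis hopfA : is_hopf_star_algebra Delta eps S stA.
Hypothesis galoisZ : is_star_galois Delta eps stA stZ alpha.
Hypothesis haarZ : positive_haar_measure alpha stZ mu.

Notation coalgA := (hopf_coalgebra hopfA).

Lemma galois_star : star_structure stZ.
Proof. by case: galoisZ. Qed.

Lemma galois_tlinear : tlinear alpha.
Proof. by have [_ _ []] := galoisZ. Qed.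

Notation ltrans := (lslice galois_tlinear).

Lemma ltrans_conv f g z : ltrans f (ltrans g z) = ltrans (conv coalgA g f) z.
Proof.
have [_ _ [_ coassoc _] _ _] := galoisZ.
apply: functional_ext => h; rewrite [RHS]scalar_lslice.
rewrite -[LHS]/((h \o ltrans f) (ltrans g z)) scalar_lslice.
have := coassoc z g f h; rewrite !big_allpairs_dep /= => gfh.
under eq_bigr do rewrite scalar_lslice mulr_sumr.
under [RHS]eq_bigr do rewrite scalar_rslice mulr_suml.
by rewrite -gfh; apply: eq_bigr => p _; apply: eq_bigr => q _; rewrite mulrA.
Qed.

Lemma ltrans_counit z : ltrans (counit coalgA) z = z.
Proof.
have [_ _ [_ _ counitl] _ _] := galoisZ; rewrite lsliceE -[RHS]counitl.
by apply: eq_bigr => p _; rewrite counitE.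
Qed.

Lemma ltrans1 f : ltrans f 1 = f 1 *: 1.
Proof.
by have [_ _ _ [_ /(teq_lslice galois_tlinear)-> _] _] := galoisZ; rewrite big_seq1.
Qed.

Lemma galois_inj (t : seq (Z * Z)) :
  (forall f, \sum_(p <- t) ltrans f p.1 * p.2 = 0) -> teq t [::].
Proof.
have [_ _ _ _ [beta_inj _]] := galoisZ; move=> t0; apply: beta_inj; apply/teqP => f.
rewrite big_allpairs_dep /= big_nil -[RHS](t0 f); apply: eq_bigr => p _.
by rewrite lsliceE mulr_suml; apply: eq_bigr => q _; rewrite scalerAl.
Qed.

Lemma galois_surj (s : seq (A * Z)) : exists t : seq (Z * Z),
  forall f, \sum_(p <- t) ltrans f p.1 * p.2 = \sum_(p <- s) f p.1 *: p.2.
Proof.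
have [_ _ _ _ [_ /(_ s)[t /teqP ts]]] := galoisZ; exists t => f; rewrite -ts.
rewrite big_allpairs_dep; apply: eq_bigr => p _ /=.
by rewrite lsliceE mulr_suml; apply: eq_bigr => q _; rewrite scalerAl.
Qed.

Lemma haar_scalar : scalar mu.
Proof. by case: haarZ. Qed.

Definition haar : {scalar Z} := linear_of haar_scalar.

Lemma haar1 : haar 1 = 1.
Proof. by rewrite linear_ofE; case: haarZ. Qed.

Lemma haar_ge0 z : 0 <= haar (stZ z * z).
Proof. by rewrite linear_ofE; case: haarZ. Qed.

Lemma map_haar_alg_mx m n (X : 'M[C]_(m, n)) : map_mx haar (alg_mx X) = X.
Proof. by apply/matrixP => i j; rewrite !mxE linearZ /= haar1 mulr1. Qed.

Lemma gram_psdmx m n (z : 'M[Z]_(m, n)) (H : 'M[C]_n) :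
  star_mx stZ z *m z = alg_mx H -> psdmx H.
Proof.
have starZ := galois_star => zH; split=> [|v].
  rewrite -[LHS]map_haar_alg_mx -(star_alg_mx starZ) -zH.
  by rewrite (star_mxM starZ) (star_mxK starZ) zH map_haar_alg_mx.
pose x := z *m alg_mx v.
have -> : v^t* *m H *m v = map_mx haar (star_mx stZ x *m x).
  rewrite (star_mxM starZ) (star_alg_mx starZ) !mulmxA -(mulmxA _ _ z) zH.
  by rewrite -!map_mxM map_haar_alg_mx.
rewrite !mxE raddf_sum; apply: sumr_ge0 => i _.
by rewrite mxE; apply: haar_ge0.
Qed.

Definition equivariant m n (u : 'M[A]_m) (z : 'M[Z]_(m, n)) : Prop :=
  forall f : {scalar A}, map_mx (ltrans f) z = alg_mx (map_mx f u) *m z.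

Lemma equivariantP m n (u : 'M[A]_m) (z : 'M[Z]_(m, n)) :
  equivariant u z <->
  forall i j, teq (alpha (z i j)) [seq (u i k, z k j) | k <- enum 'I_m].
Proof.
split=> [uz i j|uz f].
  apply/(teq_lslice galois_tlinear) => f; have /matrixP/(_ i j) := uz f.
  rewrite !mxE big_map big_enum => ->; apply: eq_bigr => k _.
  by rewrite !mxE mulr_algl.
apply/matrixP => i j; rewrite !mxE.
have /(teq_lslice galois_tlinear)-> := uz i j; rewrite big_map big_enum.
apply: eq_bigr => k _.
by rewrite !mxE mulr_algl.
Qed.

Lemma equivariant_col m n (u : 'M[A]_m) (z : 'M[Z]_(m, n)) :
  equivariant u z <-> forall j, equivariant u (col j z).
Proof.
split=> [uz j f|uz f]; first by rewrite map_col uz !colE mulmxA.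
apply/matrixP => i j; suff /colP/(_ i) : col j (map_mx (ltrans f) z) =
    col j (alg_mx (map_mx f u) *m z) by rewrite [LHS]mxE [RHS]mxE.
by rewrite -map_col uz !colE mulmxA.
Qed.

Lemma equivariant_alg_mulmx m n p (u : 'M[A]_m) (z : 'M[Z]_(m, n)) (Q : 'M[C]_(n, p)) :
  equivariant u z -> equivariant u (z *m alg_mx Q).
Proof. by move=> uz f; rewrite map_linear_alg_mxr uz mulmxA. Qed.

Lemma equivariant1 m : equivariant (1%:M : 'M[A]_m) (1%:M : 'M[Z]_m).
Proof.
move=> f; rewrite mulmx1 map_scalar_mx1; apply/matrixP => i j; rewrite !mxE.
by case: (i == j); rewrite ?raddf0 // ltrans1.
Qed.

(* Injectivity of the Galois map turns [f(u) w y v = f(u) v] into the identity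
   [sum_k w_k (x) (y v)_k = v (x) 1], whose second leg is then integrated. *)
Lemma equivariant_expansion m n p (u : 'M[A]_m) (w : 'M[Z]_(m, n)) (y : 'M[Z]_(n, m))
    (v : 'M[Z]_(m, p)) :
  w *m y = 1%:M -> equivariant u w -> equivariant u v ->
  v = w *m alg_mx (map_mx haar (y *m v)).
Proof.
move=> wy uw uv; apply/matrixP => i j; apply: functional_ext => h.
pose t := (v i j, 1) :: [seq (w i k, - (y *m v) k j) | k <- enum 'I_n].
have /(_ h haar) : teq t [::].
  apply: galois_inj => f; rewrite big_cons big_map big_enum /= mulr1.
  have : map_mx (ltrans f) v i j = (map_mx (ltrans f) w *m (y *m v)) i j.
    by rewrite uw !mulmxA -(mulmxA _ w) wy mulmx1 uv.
  rewrite [LHS]mxE [RHS]mxE => ->; rewrite -big_split big1 // => k _ /=.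
  by rewrite mxE mulrN subrr.
rewrite big_cons big_map big_enum big_nil /= haar1 mulr1 => /eqP.
rewrite addr_eq0 -sumrN => /eqP ->; rewrite mxE raddf_sum; apply: eq_bigr => k _ /=.
by rewrite raddfN mulrN opprK !mxE mulr_algr linearZ mulrC.
Qed.

Lemma coinvariant_scalar m n (v : 'M[Z]_(m, n)) :
  equivariant 1%:M v -> v = alg_mx (map_mx haar v).
Proof.
move=> v_coinv; have one_inv : 1%:M *m 1%:M = 1%:M :> 'M[Z]_m by rewrite mulmx1.
by rewrite {1}(equivariant_expansion one_inv (@equivariant1 m) v_coinv) !mul1mx.
Qed.

Lemma equivariant_gram m n (u : 'M[A]_m) (z : 'M[Z]_(m, n)) :
  star_mx stA u *m u = 1%:M -> equivariant u z ->
  equivariant 1%:M (star_mx stZ z *m z).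
Proof.
move=> uu /equivariantP uz f; have [_ _ _ [alphaM _ alpha_star] _] := galoisZ.
have uzz i j k : ltrans f (stZ (z i j) * z i k) =
    \sum_s \sum_t f (stA (u i s) * u i t) *: (stZ (z s j) * z t k).
  have star_z := teq_star (hopf_star hopfA) galois_star (uz i j).
  have := teq_tmul (teq_trans (alpha_star _) star_z) (uz i k).
  move=> /(teq_trans (alphaM _ _))/(teq_lslice galois_tlinear)->.
  rewrite /tmul big_allpairs_dep /= big_map big_map big_enum; apply: eq_bigr => s _.
  by rewrite big_map big_enum.
have f_uu s t : \sum_i f (stA (u i s) * u i t) = f (s == t)%:R.
  have /matrixP/(_ s t) := uu; rewrite !mxE => <-; rewrite raddf_sum.
  by apply: eq_bigr => i _; rewrite mxE.
apply/matrixP => j k; rewrite map_scalar_mx1 map_scalar_mx mul_scalar_mx.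
rewrite !mxE raddf_sum mulr_sumr /=.
under eq_bigr do rewrite mxE uzz; rewrite exchange_big; apply: eq_bigr => s _ /=.
rewrite exchange_big (bigD1 s) //= [X in _ + X]big1 => [|t /negPf ts].
  by rewrite -scaler_suml f_uu eqxx addr0 mxE mulr_algl.
by rewrite -scaler_suml f_uu eq_sym ts raddf0 scale0r.
Qed.

Section Isotypic.
Variables (I : eqType) (n : I -> nat) (a : forall l : I, 'M[A]_(n l)).
Variable G : entry_index n n -> {scalar A}.
Hypothesis a_irr : forall l, irr_corep Delta eps (a l).
Hypothesis a_unitary : forall l, unitary_mx stA (a l).
Hypothesis a_span : forall x, span (range (entries a)) x.
Hypothesis Ga : biorthogonal G (entries a).

Lemma map_dual_same l (i k : 'I_(n l)) : map_mx (G (index_of i k)) (a l) = delta_mx i k.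
Proof.
apply/matrixP => r s; rewrite !mxE (Ga _ (index_of r s)) eq_Tagged /= xpair_eqE.
by rewrite [r == i]eq_sym [s == k]eq_sym.
Qed.

Lemma map_dual_neq l l' (i k : 'I_(n l)) :
  l != l' -> map_mx (G (index_of i k)) (a l') = 0.
Proof.
move=> ll'; apply/matrixP => r s; rewrite !mxE (Ga _ (index_of r s)).
by case: eqP => // /(congr1 tag) /= /eqP; rewrite (negPf ll').
Qed.

Lemma conv_dual l (i k : 'I_(n l)) f x :
  conv coalgA (G (index_of i k)) f x = \sum_s f (a l k s) * G (index_of i s) x.
Proof.
pose P := [set x |
  conv coalgA (G (index_of i k)) f x = \sum_s f (a l k s) * G (index_of i s) x].
apply: (smallest_sub (X := P)) (a_span x); last move=> _ [[l' [r t]] _ <-].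
  rewrite /P /mkset; split=> [|c y z]; rewrite ?raddf0 ?linearP.
    by rewrite big1 // => s _; rewrite raddf0 mulr0.
  move=> -> ->; rewrite /= mulr_sumr -big_split; apply: eq_bigr => s _ /=.
  by rewrite linearP /= mulrDr mulrCA.
rewrite /P /mkset -[entries a _]/(a l' r t).
have -> : conv coalgA (G (index_of i k)) f (a l' r t) =
    (map_mx (G (index_of i k)) (a l') *m map_mx f (a l')) r t.
  by have [/(corepP coalgA)[aconv _] _ _] := a_irr l'; rewrite -aconv mxE.
have [ll'|ll'] := eqVneq l l'; last first.
  rewrite map_dual_neq // mul0mx mxE big1 // => s _.
  by have /matrixP/(_ r t) := map_dual_neq i s ll'; rewrite !mxE => ->; rewrite mulr0.
case: _ / ll' in r t *; rewrite map_dual_same mxE.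
have dualE s : G (index_of i s) (a l r t) = ((r == i) && (t == s))%:R.
  by have /matrixP/(_ r t) := map_dual_same i s; rewrite !mxE.
under eq_bigr do rewrite !mxE; under [RHS]eq_bigr do rewrite dualE.
rewrite (bigD1 k) //= big1 => [|s /negPf sk]; last by rewrite sk andbF mul0r.
rewrite (bigD1 t) //= big1 => [|s /negPf st]; last first.
  by rewrite [t == s]eq_sym st andbF mulr0.
by rewrite !eqxx !andbT !addr0 mulrC.
Qed.

Definition component l (i : 'I_(n l)) (z : Z) : 'cV[Z]_(n l) :=
  \col_k ltrans (G (index_of i k)) z.

Lemma component_equivariant l (i : 'I_(n l)) z : equivariant (a l) (component i z).
Proof.
move=> f; apply/matrixP => k j; rewrite !mxE ltrans_conv lsliceE.
under eq_bigr do rewrite conv_dual scaler_suml; rewrite exchange_big.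
apply: eq_bigr => s _ /=; rewrite !mxE mulr_algl lsliceE scaler_sumr.
by apply: eq_bigr => p _; rewrite scalerA.
Qed.

Lemma equivariant_right_inverse l : exists p (w : 'M[Z]_(n l, p)) (y : 'M[Z]_(p, n l)),
  equivariant (a l) w /\ w *m y = 1%:M.
Proof.
have [_ n_gt0 _] := a_irr l; pose i0 : 'I_(n l) := Ordinal n_gt0.
have /choice[t tP] (k : 'I_(n l)) : exists t : seq (Z * Z), forall f,
    \sum_(p <- t) ltrans f p.1 * p.2 = f (a l i0 k) *: 1.
  by have [t tE] := galois_surj [:: (a l i0 k, 1)]; exists t => f; rewrite tE big_seq1.
pose cols := [seq (component i0 p.1, p.2 *: delta_mx 0 k : 'rV[Z]_(n l))
             | k <- enum 'I_(n l), p <- t k].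
exists (size cols), (\matrix_(i, j) (tnth (in_tuple cols) j).1 i 0).
exists (\matrix_(j, k) (tnth (in_tuple cols) j).2 0 k); split.
  apply/equivariant_col => j.
  have /allpairsPdep[k [p [_ _ colE]]] := mem_tnth j (in_tuple cols).
  rewrite (_ : col j _ = component i0 p.1); first exact: component_equivariant.
  by apply/colP => i; rewrite !mxE colE !mxE.
apply/matrixP => i k; rewrite mxE.
transitivity (\sum_(x <- cols) x.1 i 0 * x.2 0 k).
  by rewrite (big_tnth _ _ cols); apply: eq_bigr => j _; rewrite !mxE.
rewrite big_allpairs_dep big_enum (bigD1 k) //= [X in _ + X]big1 => [|k' /negPf k'k].
  under eq_bigr do rewrite !mxE !eqxx mulr1.
  by rewrite tP (Ga _ (index_of i0 k)) eq_Tagged /= xpair_eqE eqxx addr0 scaler_nat mxE.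
by rewrite big1 // => p _; rewrite !mxE eq_sym k'k andbF !mulr0.
Qed.

Lemma unitary_equivariant_generators l : exists p (z : 'M[Z]_(n l, p)),
  [/\ (0 < p)%N, equivariant (a l) z, unitary_mx stZ z
    & forall v : 'cV[Z]_(n l), equivariant (a l) v ->
        exists c : 'cV[C]_p, v = z *m alg_mx c].
Proof.
have [q [w [y [wequiv wy]]]] := equivariant_right_inverse l.
have ww := coinvariant_scalar (equivariant_gram (a_unitary l).1 wequiv).
have [p [R [R_free HR]]] := psdmx_rank_factorization (gram_psdmx ww).
rewrite HR in ww; have RQ := mulmxVp R_free.
have [z_unitary wz] := unitary_mx_of_gram galois_star wy RQ ww.
set z := w *m _ in z_unitary wz; exists p, z; split=> //.
- have [_ n_gt0 _] := a_irr l; have [Z_neq0 _ _ _ _] := galoisZ.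
  exact: right_invertible_mx_gt0 Z_neq0 n_gt0 z_unitary.2.
- exact: equivariant_alg_mulmx.
- move=> v vequiv; rewrite (equivariant_expansion wy wequiv vequiv).
  set c := map_mx haar _; exists (R *m c).
  by rewrite map_mxM mulmxA -wz.
Qed.

Lemma unitary_equivariant_family : exists (p : I -> nat) (z : forall l, 'M[Z]_(n l, p l)),
  [/\ forall l, (0 < p l)%N, forall l, equivariant (a l) (z l),
      forall l, unitary_mx stZ (z l)
    & forall l (v : 'cV[Z]_(n l)), equivariant (a l) v ->
        exists c : 'cV[C]_(p l), v = z l *m alg_mx c].
Proof.
have /choice[p /choice_dep[z zP]] := unitary_equivariant_generators.
by exists p, z; split=> l; have [] := zP l.
Qed.

Section Generators.
Variables (p : I -> nat) (z : forall l, 'M[Z]_(n l, p l)).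
Hypothesis z_equiv : forall l, equivariant (a l) (z l).
Hypothesis z_unitary : forall l, unitary_mx stZ (z l).
Hypothesis z_generates : forall l (v : 'cV[Z]_(n l)), equivariant (a l) v ->
  exists c : 'cV[C]_(p l), v = z l *m alg_mx c.

Lemma component_entry_same l (i i' : 'I_(n l)) (j' : 'I_(p l)) :
  component i (z l i' j') = if i == i' then col j' (z l) else 0.
Proof.
apply/colP => k; rewrite mxE.
have /matrixP/(_ i' j') := z_equiv l (G (index_of i k)); rewrite [LHS]mxE => ->.
rewrite map_dual_same map_delta_mx mxE (bigD1 k) //= big1 => [|s /negPf sk].
  by rewrite !mxE eqxx andbT addr0 eq_sym; case: eqP; rewrite ?mul1r ?mul0r mxE.
by rewrite mxE sk andbF mul0r.
Qed.

Lemma component_entry_neq l l' (i : 'I_(n l)) (i' : 'I_(n l')) (j' : 'I_(p l')) :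
  l != l' -> component i (z l' i' j') = 0.
Proof.
move=> ll'; apply/colP => k; rewrite mxE.
have /matrixP/(_ i' j') := z_equiv l' (G (index_of i k)); rewrite [LHS]mxE => ->.
by rewrite map_dual_neq // map_mx0 mul0mx !mxE.
Qed.

Lemma coordinate_scalar l (i : 'I_(n l)) (j : 'I_(p l)) :
  scalar (fun v => haar ((star_mx stZ (z l) *m component i v) j 0)).
Proof.
move=> c u v; rewrite -linearP /=; congr (haar _); rewrite !mxE.
rewrite scaler_sumr -big_split; apply: eq_bigr => k _ /=.
by rewrite !mxE linearP mulrDr scalerAr.
Qed.

Lemma generators_biorthogonal :
  exists h : entry_index n p -> {scalar Z}, biorthogonal h (entries z).
Proof.
exists (fun x => linear_of (coordinate_scalar (projT2 x).1 (projT2 x).2)).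
move=> [l [i j]] [l' [i' j']]; rewrite linear_ofE /entries /=.
have [ll'|ll'] := eqVneq l l'; last first.
  rewrite component_entry_neq // mulmx0 mxE raddf0.
  by case: eqP => // /(congr1 tag) /= /eqP; rewrite (negPf ll').
case: _ / ll' in i' j' *; rewrite component_entry_same eq_Tagged /= xpair_eqE.
case: eqP => _ /=; last by rewrite mulmx0 mxE raddf0.
rewrite colE mulmxA (z_unitary l).1 mul1mx !mxE eqxx andbT.
by case: (j == j'); rewrite ?haar1 ?raddf0.
Qed.

Lemma generators_spanning v : span (range (entries z)) v.
Proof.
apply: span_functional => f f0; rewrite -(ltrans_counit v) slice_swap.
rewrite (biorthogonal_span_eq0 Ga (a_span (rslice galois_tlinear f v))) ?raddf0 //.
move=> [l [i k]].
rewrite -slice_swap; have [c /colP/(_ k)] := z_generates (component_equivariant i v).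
rewrite mxE => ->; rewrite mxE raddf_sum big1 // => j _ /=.
by rewrite mxE mulr_algr linearZ /= f0 ?mulr0 //; exists (index_of k j).
Qed.

End Generators.

End Isotypic.

End GaloisExtension.

Theorem theorem5p1p1
  (A : algType C) (Delta : A -> seq (A * A)) (eps : A -> C) (S : A -> A)
  (stA : A -> A)
  (Z : algType C) (stZ : Z -> Z) (alpha : Z -> seq (A * Z)) (mu : Z -> C) :
  is_hopf_star_algebra Delta eps S stA ->
  unitarizable Delta eps stA ->
  is_star_galois Delta eps stA stZ alpha ->
  positive_haar_measure alpha stZ mu ->
  (* I indexes \widehat A via the irreducible corepresentations a λ,
     n λ = n_λ, and Z(λ) = span of the z λ i j *)
  exists (I : Type) (n p : I -> nat)
         (z : forall l : I, 'M[Z]_(n l, p l)) (a : forall l : I, 'M[A]_(n l)),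
  [/\ (* I ≃ \widehat A : the a λ form a complete set of representatives of
         the isomorphism classes of irreducible finite-dimensional comodules *)
      [/\ forall l, irr_corep Delta eps (a l),
          forall l l', l <> l' -> ~ corep_equiv (a l) (a l')
        & forall (m : nat) (u : 'M[A]_m), irr_corep Delta eps u ->
            exists l, corep_equiv u (a l)],
      (* p λ > 0, and Z = ⊕_λ Z(λ) with the z^λ_ij a basis of Z *)
      (forall l, (0 < p l)%N),
      basis_family (fun x : {l : I & ('I_(n l) * 'I_(p l))%type} =>
                      z (projT1 x) (projT2 x).1 (projT2 x).2),
      (* the orthogonality relations *)
      [/\ forall l (j k : 'I_(p l)),
            \sum_(i < n l) stZ (z l i j) * z l i k = (j == k)%:R
        & forall l (i k : 'I_(n l)),
            \sum_(j < p l) z l i j * stZ (z l k j) = (i == k)%:R]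
    & (* the a^λ_ij form a basis of A, each a λ is unitary, and
         α_Z(z^λ_ij) = Σ_k a^λ_ik ⊗ z^λ_kj *)
      [/\ basis_family (fun x : {l : I & ('I_(n l) * 'I_(n l))%type} =>
                          a (projT1 x) (projT2 x).1 (projT2 x).2),
          forall l, mx_star stA (a l) *m a l = 1%:M /\
                    a l *m mx_star stA (a l) = 1%:M
        & forall l (i : 'I_(n l)) (j : 'I_(p l)),
            teq (alpha (z l i j)) [seq (a l i k, z l k j) | k <- enum 'I_(n l)]]].
Proof.
move=> hopfA unitA galoisZ haarZ.
have [I [n [a [a_reps a_unitary]]]] := unitary_representatives hopfA unitA.
have [a_irr a_inequiv _] := a_reps.
have [G Ga] := entries_biorthogonal (hopf_coalgebra hopfA) a_irr a_inequiv.
have a_span := entries_spanning hopfA unitA a_reps.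
have [p [z [p_gt0 z_equiv z_unitary z_generates]]] :=
  unitary_equivariant_family hopfA galoisZ haarZ a_irr a_unitary a_span Ga.
have [h hz] := generators_biorthogonal haarZ Ga z_equiv z_unitary.
have z_span := generators_spanning hopfA a_irr a_span Ga z_generates.
exists I, n, p, z, a; split=> //.
- exact: biorthogonal_basis hz z_span.
- by split=> l; have [] := unitary_mx_relations (z_unitary l).
- split=> // [|l]; first exact: biorthogonal_basis Ga a_span.
  exact: (equivariantP galoisZ _ _).1 (z_equiv l).
Qed.
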